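(* Let $C_0>0$ be a fixed constant, and define the functions $x_k$, $h$, $\psi$, $F$ as in the context below. (i) There exists a set $A$ of natural numbers such that $$\sum_{n \in A:\, n \leq x} \frac{1}{n} \asymp F(x)$$ for all sufficiently large $x$, and such that, with $\mathbf{n}=\mathbf{n}_x$, $\mathbf{m}=\mathbf{m}_x$ as defined in the context, $$\mathbb{E} \gcd(\mathbf{n}, \mathbf{m}) - 1 \ll \exp(e^2 C_0^2)-1+o(1)$$ as $x \to \infty$. (ii) Conversely, there is a quantity $o(1)$ (depending only on $C_0$ and $x$, tending to $0$ as $x\to\infty$, and not depending on $A$) such that for all sufficiently large $x$ the following holds: if $A$ is a set of natural numbers such that, for this $x$, the set $\{n\in A: n\le x\}$ is nonempty and $$\mathbb{E} \gcd(\mathbf{n}, \mathbf{m}) - 1 \leq C_0^2,$$ then $$\sum_{n \in A:\, n \leq x} \frac{1}{n} \leq \exp\left( (C_0+o(1)) (\operatorname{Log}_2 x)^{1/2} \operatorname{Log}_3 x \right).$$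
   Context: Notation: $\operatorname{Log} x := \max(\log x, 1)$, $\operatorname{Log}_2 x := \operatorname{Log}\operatorname{Log} x$, $\operatorname{Log}_3 x := \operatorname{Log}\operatorname{Log}\operatorname{Log} x$ for $x>0$. For a set $A\subset\mathbb{N}$ and $x$ with $\{n\in A: n\le x\}$ nonempty, let $\mathbf{n}=\mathbf{n}_x$ be a random element of $\{n \in A: n \le x\}$ with the logarithmic distribution $\mathbb{P}(\mathbf{n}=n) = \frac{1/n}{\sum_{m\in A: m\le x} 1/m}$, and let $\mathbf{m}=\mathbf{m}_x$ be an independent copy of $\mathbf{n}$. For each natural number $k \geq C_0$ put $x_k := \exp\exp(k^2/C_0^2)$. For $x_k < x \leq x_{k+1}$ define $h(x) := \operatorname{Log}_2 x - k^2/C_0^2 + 1$, $\psi(x) := 1 + h(x)^2/h(x_{k+1})$, and $F(x) := \psi(x)\, \frac{k^{2k} C_0^{-2k}}{k!}$ (these are defined for all sufficiently large $x$). Asymptotic notation: $X \ll Y$ means $|X| \le CY$ for an absolute constant $C$, $X \asymp Y$ means $X \ll Y \ll X$, and $o(1)$ denotes a quantity tending to zero as $x\to\infty$ (the decay rate may depend on $C_0$). *)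

(* Defs.v *)
From HB Require Import structures.
From mathcomp Require Import all_boot all_order all_algebra.
From mathcomp Require Import all_classical all_reals all_analysis.

Set Implicit Arguments.
Unset Strict Implicit.
Unset Printing Implicit Defensive.

Import Order.TTheory GRing.Theory Num.Theory.
Import numFieldNormedType.Exports.

Local Open Scope classical_set_scope.
Local Open Scope ring_scope.

Section Defs.
Context {R : realType}.
Implicit Types (C x : R) (A : set nat) (k n : nat).

(* The relations X << Y and X << Y << X with the implied constant C made explicit, so that its
   independence of all parameters is visible in the quantifier structure. *)
Definition ll C (X Y : R) : Prop := `|X| <= C * Y.

Definition asymp C (X Y : R) : Prop := ll C X Y /\ ll C Y X.

Definition Log x : R := Num.max (ln x) 1.
Definition Log2 x : R := Log (Log x).
Definition Log3 x : R := Log (Log (Log x)).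

Definition upto A x : set nat := [set n | A n /\ n%:R <= x].

Lemma finite_upto A x : finite_set (upto A x).
Proof.
apply: (sub_finite_set _ (finite_II (Num.truncn x).+1)) => n [_ nx] /=.
by rewrite ltnS truncn_ge_nat // (le_trans _ nx).
Qed.

Definition logsum A x : R := \sum_(n \in upto A x) (n%:R^-1 : R).

(* Meaningful only for n in the support [upto A x] of the law. *)
Definition logprob A x n : R := n%:R^-1 / logsum A x.

(* Expectation of gcd(n, m) under the product law on [upto A x] x [upto A x],
   i.e. for n, m independent and both distributed according to [logprob]. *)
Definition Egcd A x : R :=
  \sum_(n \in upto A x) \sum_(m \in upto A x)
    ((gcdn n m)%:R * (logprob A x n * logprob A x m) : R).

Definition xk (C0 : R) k : R := expR (expR (k%:R ^+ 2 / C0 ^+ 2)).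

Definition kblock (C0 : R) x : set nat :=
  [set k | C0 <= k%:R /\ xk C0 k < x <= xk C0 k.+1].

Lemma kblock_uniq (C0 : R) x k l : 0 < C0 ->
  kblock C0 x k -> kblock C0 x l -> k = l.
Proof.
move=> C0_gt0 [_ /andP[kx xk1]] [_ /andP[lx xl1]].
have xk_lt i j : xk C0 i < xk C0 j -> (i < j)%N.
  rewrite /xk !ltr_expR ltr_pM2r ?invr_gt0 ?exprn_gt0 //.
  by rewrite ltr_pXn2r ?nnegrE ?ler0n // ltr_nat.
have kl : (k < l.+1)%N by apply: xk_lt; exact: lt_le_trans kx xl1.
have lk : (l < k.+1)%N by apply: xk_lt; exact: lt_le_trans lx xk1.
by apply/eqP; rewrite eqn_leq -ltnS kl -ltnS lk.
Qed.

(* The k with k >= C0 and x_k < x <= x_(k+1), unique by [kblock_uniq]; it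
   exists for all large x, and the default value 0 is used otherwise. *)
Definition kof (C0 : R) x : nat := xget 0%N (kblock C0 x).

Definition h (C0 : R) x : R := Log2 x - (kof C0 x)%:R ^+ 2 / C0 ^+ 2 + 1.

Definition psi (C0 : R) x : R := 1 + h C0 x ^+ 2 / h C0 (xk C0 (kof C0 x).+1).

Definition F (C0 : R) x : R :=
  let k := kof C0 x in
  psi C0 x * (k%:R ^+ (2 * k) * C0 ^- (2 * k) / k`!%:R).

End Defs.

(* Main.v *)
Require Import Defs.
From HB Require Import structures.
From mathcomp Require Import all_boot all_order all_algebra.
From mathcomp Require Import all_classical all_reals all_analysis.
From mathcomp Require Import zify ring lra.

Set Implicit Arguments.
Unset Strict Implicit.
Unset Printing Implicit Defensive.

Import Order.TTheory GRing.Theory Num.Theory.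
Import numFieldNormedType.Exports.

Local Open Scope classical_set_scope.
Local Open Scope ring_scope.

(** Writing [gcd(n, m) - 1] as the sum of [phi d] over the common divisors [d > 1] turns
    [(E gcd - 1) L^2], with [L] the logarithmic sum of [A], into the positive quadratic form
    [Q = sum_(d > 1) phi(d) S_d^2], where [S_d = sum_(d | n) 1/n].

    Part (ii).  Keeping only prime [d], Cauchy-Schwarz bounds the mean number [w] of prime
    factors of [n] by [C0 sqrt M], [M = sum_(p <= x) 1/(p - 1)].  By convexity,
    [L M^(-w) <= sum_(n <= x) M^(-omega n) / n], which an Euler product bounds by [exp 1];
    so [L <= e M^(C0 sqrt M)], and [M <= Log2 x + O(1)] by Mertens' theorem.

    Part (i).  [A] is the union over large [k] of the sets [A_k] of products of [k - 1] distinct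
    primes in [(T, x_k^(1/2k)]] and two distinct primes in [(x_k, x_(k+1)^(1/4)]].  The masses
    are products of elementary symmetric sums of reciprocals of primes, which are close to
    [M^r / r!]; the first factor has size [g_k C0^2 / k], [g_k = k^(2k) C0^(-2k) / k!], the
    second [h^2 / 2], while the full block [A_(k-1)] provides the constant term of [psi].  Pairs
    sharing [l] small primes contribute a proportion [C0^(2l) / l!], so the small primes cost a
    factor [exp(C0^2)]; the pairs sharing a large prime are negligible.  Since [sqrt Q] is a norm
    and the blocks grow faster than geometrically, the blocks can be treated one at a time. *)

(** * Chebyshev's upper bound for the product of the primes up to [n] *)

Section Chebyshev.

Lemma prod_primes_dvdn (s : seq nat) (N : nat) :
  uniq s -> all prime s -> all (dvdn^~ N) s -> (\prod_(p <- s) p %| N)%N.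
Proof.
elim: s => [|p s IH] /=; first by rewrite big_nil dvd1n.
move=> /andP[ps us] /andP[pp As] /andP[pN Ns]; rewrite big_cons.
rewrite Gauss_dvd ?pN ?IH //.
rewrite coprime_sym big_seq; apply: (big_ind (fun m => coprime m p)).
- exact: coprime1n.
- by move=> x y cx cy; rewrite coprimeMl cx.
move=> q qs; have pq : prime q by exact: (allP As).
rewrite prime_coprime // dvdn_prime2 //.
by apply: contraNneq ps => <-.
Qed.

(** The two equal middle coefficients of row [2m+1] both occur in the expansion of
    [(1 + 1)^(2m+1)]. *)
Lemma bin_odd_le (m : nat) : ('C(m.*2.+1, m) <= 4 ^ m)%N.
Proof.
have : (('C(m.*2.+1, m)).*2 <= 2 ^ m.*2.+1)%N.
  rewrite -[X in (X ^ _)%N](_ : 1 + 1 = 2)%N // expnDn.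
  have mlt : (m < m.*2.+2)%N by lia.
  have m1lt : (m.+1 < m.*2.+2)%N by lia.
  rewrite (bigD1 (Ordinal mlt)) //= (bigD1 (Ordinal m1lt)) /=; last first.
    by apply/negP => /eqP /(congr1 val) /=; lia.
  rewrite !exp1n !muln1 addnA -addnn.
  have -> : 'C(m.*2.+1, m.+1) = 'C(m.*2.+1, m).
    by rewrite -bin_sub; [congr ('C(_, _)); lia | lia].
  exact: leq_addr.
rewrite expnS -muln2 mulnC leq_pmul2l //.
by rewrite -muln2 mulnC expnM.
Qed.

Definition primorial (n : nat) : nat := \prod_(0 <= p < n.+1 | prime p) p.

(** Erdos's induction: an even [n > 2] adds no prime, and for [n = 2m+1] the primes in [(m+1, n]]
    all divide ['C(n, m)], since they divide [n!] but neither [m!] nor [(m+1)!]. *)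
Lemma primorial_le (n : nat) : (primorial n <= 4 ^ n)%N.
Proof.
have [k] := ubnP n; elim: k n => // k IH n nk.
have [n2|n2] := leqP n 2.
  case: n n2 {nk} => [|[|[|n]]] // _; rewrite /primorial unlock //.
have [on|en] := boolP (odd n); last first.
  have -> : primorial n = primorial n.-1.
    rewrite /primorial big_mkcond big_nat_recr //= -big_mkcond /=.
    have -> : prime n = false.
      by apply/negP => /even_prime[|on]; [lia|rewrite on in en].
    by rewrite muln1 prednK //; lia.
  apply: (@leq_trans (4 ^ n.-1)); first by apply: IH; lia.
  by rewrite leq_exp2l; lia.
have nE : n = (n./2).*2.+1 by rewrite -[LHS]odd_double_half on.
set m := n./2 in nE.
have m1 : (0 < m)%N by lia.
rewrite /primorial (@big_cat_nat _ _ _ m.+2) //=; last by lia.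
have h1 : (\prod_(0 <= p < m.+2 | prime p) p <= 4 ^ m.+1)%N by apply: IH; lia.
have h2 : (\prod_(m.+2 <= p < n.+1 | prime p) p <= 4 ^ m)%N.
  apply: leq_trans (bin_odd_le m); apply: dvdn_leq; first by rewrite bin_gt0; lia.
  rewrite -big_filter; apply: prod_primes_dvdn.
  - by rewrite filter_uniq // iota_uniq.
  - by apply/allP => p; rewrite mem_filter => /andP[].
  apply/allP => p; rewrite mem_filter mem_index_iota => /andP[pp /andP[p1 p2]].
  have: (p %| 'C(m.*2.+1, m) * (m`! * (m.*2.+1 - m)`!))%N.
    rewrite bin_fact; last by lia.
    by rewrite dvdn_fact //; lia.
  have dfact k' : (k' < p)%N -> (p %| k'`!)%N = false.
    elim: k' => [|k' IHk] kp; first by rewrite fact0 dvdn1; apply/negbTE; lia.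
    by rewrite factS Euclid_dvdM // IHk ?(ltnW kp) // orbF gtnNdvd.
  by rewrite !Euclid_dvdM // !dfact ?orbF //; lia.
apply: (leq_trans (leq_mul h1 h2)).
by rewrite -expnD leq_exp2l //; lia.
Qed.

End Chebyshev.

(** * Mertens' theorems for the sums of [ln p / p] and [1 / p], from the factorization of [n!] *)

Section Mertens.
Variable R : realType.
Local Notation ln := (@ln R).

Lemma ln_nat_ge0 (n : nat) : 0 <= ln n%:R.
Proof.
case: n => [|n]; first by rewrite ln0.
by rewrite ln_ge0 // ler1n.
Qed.

Lemma ln_le_subr1 (x : R) : 0 < x -> ln x <= x - 1.
Proof.
by move=> x0; have := @le_ln1Dx R (x - 1); rewrite subrKC; apply; lra.
Qed.

Definition logp (n : nat) : R := \sum_(0 <= p < n.+1 | prime p) ln p%:R / p%:R.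
Definition recp (n : nat) : R := \sum_(0 <= p < n.+1 | prime p) p%:R^-1.

Lemma theta_le (n : nat) :
  \sum_(0 <= p < n.+1 | prime p) ln p%:R <= n%:R * ln 4.
Proof.
have := primorial_le n; rewrite -(ler_nat R) natrX => le4.
have e : \sum_(0 <= p < n.+1 | prime p) ln p%:R = ln (primorial n)%:R.
  rewrite /primorial; elim: n {le4} => [|n IH].
    by rewrite [X in X%:R]big_mkcond [LHS]big_mkcond !big_nat1 /= ln1.
  rewrite big_mkcond big_nat_recr //= -big_mkcond IH.
  rewrite [in RHS]big_mkcond [in RHS]big_nat_recr //= -big_mkcond /=.
  case: ifP => [pn|_]; last by rewrite addr0 muln1.
  rewrite natrM lnM // posrE ltr0n //.
  by apply: prodn_cond_gt0 => i /prime_gt0.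
rewrite e mulr_natl -lnXn // ler_ln // posrE ?exprn_gt0 //.
by rewrite ltr0n; apply: prodn_cond_gt0 => i /prime_gt0.
Qed.

Lemma ln_logn (m N : nat) : (0 < m <= N)%N ->
  ln m%:R = \sum_(0 <= p < N.+1 | prime p) (logn p m)%:R * ln p%:R.
Proof.
case/andP=> m0 mN; rewrite -{1}(partnT m0) (widen_partn _ mN).
rewrite [in RHS]big_mkcond /=.
elim: (N.+1) => [|k IH]; first by rewrite !big_nil ln1.
rewrite !big_nat_recr //= natrM lnM ?posrE ?ltr0n; last first.
- by rewrite expn_gt0; case: k {IH} => //=; rewrite lognE.
- by apply: prodn_cond_gt0 => i _; rewrite expn_gt0; case: i => //=; rewrite lognE.
rewrite IH; congr (_ + _); case: ifP => pk.
  by rewrite natrX lnXn ?mulr_natl // ltr0n prime_gt0.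
by rewrite lognE pk /= expn0 ln1.
Qed.

Lemma ln_fact_logn (n N : nat) : (n <= N)%N ->
  ln n`!%:R = \sum_(0 <= p < N.+1 | prime p) (logn p n`!)%:R * ln p%:R.
Proof.
elim: n => [|n IH] nN.
  by rewrite fact0 ln1 big1 // => p _; rewrite logn1 mul0r.
rewrite factS natrM lnM ?posrE ?ltr0n ?fact_gt0 // IH ?(ltnW nN) //.
rewrite (@ln_logn _ N) // -big_split /=; apply: eq_bigr => p _.
by rewrite lognM ?fact_gt0 // natrD mulrDl.
Qed.

Lemma ln_fact_le (n : nat) : ln n`!%:R <= n%:R * ln n%:R.
Proof.
rewrite mulr_natl; case: n => [|n]; first by rewrite fact0 ln1.
rewrite -lnXn // ler_ln ?posrE ?exprn_gt0 ?ltr0n ?fact_gt0 //.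
rewrite -natrX ler_nat; elim: n.+1 => // k IH.
rewrite factS expnS leq_mul2l /=; apply: leq_trans IH _.
by case: k => // k; rewrite leq_exp2r.
Qed.

Lemma ln_fact_ge (n : nat) : n%:R * ln n%:R - n%:R <= ln n`!%:R.
Proof.
elim: n => [|[|n] IH]; first by rewrite fact0 ln1 mul0r subr0.
  by rewrite !ln1 mulr0 sub0r; lra.
rewrite factS natrM lnM ?posrE ?ltr0n ?fact_gt0 //.
set m := n.+1%:R in IH *.
have m0 : 0 < m :> R by rewrite ltr0n.
have -> : n.+2%:R = m + 1 :> R by rewrite -[n.+2]addn1 natrD.
have : ln (m + 1) - ln m <= m^-1.
  rewrite -ln_div ?posrE //; last by lra.
  rewrite mulrDl divff ?gt_eqF // mul1r le_ln1Dx //.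
  by apply: lt_trans (_ : 0 < _); [lra | rewrite invr_gt0].
rewrite -(ler_pM2l m0) divff ?gt_eqF // mulrBr.
lra.
Qed.

Lemma geo_inv_le (p m : nat) : (1 < p)%N ->
  \sum_(1 <= k < m.+1) (p%:R ^+ k)^-1 <= (p%:R - 1)^-1 :> R.
Proof.
move=> p1; have p1' : 1 < p%:R :> R by rewrite ltr1n.
suff -> : \sum_(1 <= k < m.+1) (p%:R ^+ k)^-1 =
   (1 - (p%:R ^+ m)^-1) / (p%:R - 1) :> R.
  rewrite ler_pdivrMr ?mulVf; [|lra..].
  by rewrite gerBl invr_ge0 exprn_ge0 //; lra.
elim: m => [|m IH]; first by rewrite big_geq // expr0 invr1 subrr mul0r.
rewrite big_nat_recr //= IH exprS.
have : p%:R ^+ m != 0 :> R by rewrite expf_neq0 //; apply/eqP; lra.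
move=> pm; field; rewrite pm /=; apply/andP; split; apply/eqP; lra.
Qed.

Lemma logn_fact_le (p n : nat) : prime p ->
  (logn p n`!)%:R <= n%:R / (p%:R - 1) :> R.
Proof.
move=> pp; rewrite logn_fact // natr_sum.
apply: (@le_trans _ _ (\sum_(1 <= k < n.+1) n%:R * (p%:R ^+ k)^-1)).
  apply: ler_sum => k _; rewrite ler_pdivlMr ?exprn_gt0 ?ltr0n ?prime_gt0 //.
  by rewrite -natrX -natrM ler_nat leq_divM.
by rewrite -mulr_sumr ler_wpM2l // geo_inv_le // prime_gt1.
Qed.

Lemma logn_fact_ge (p n : nat) : prime p -> (p <= n)%N ->
  n%:R / p%:R - 1 <= (logn p n`!)%:R :> R.
Proof.
move=> pp pn; have p0 : 0 < p%:R :> R by rewrite ltr0n prime_gt0.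
have p1 := prime_gt0 pp.
rewrite logn_fact // big_ltn; last by lia.
rewrite expn1 natrD.
have : n%:R / p%:R <= (n %/ p)%:R + 1 :> R.
  rewrite ler_pdivrMr // natr1 -natrM ler_nat ltnW // ltn_ceil //.
have : 0 <= (\sum_(2 <= k < n.+1) n %/ p ^ k)%:R :> R by [].
lra.
Qed.

(** Keep only the first power of [p] in Legendre's formula, at a rounding cost of 1 per prime; the
    total cost is Chebyshev's function, bounded by [theta_le]. *)
Lemma logp_le (n : nat) : (0 < n)%N -> logp n <= ln n%:R + ln 4.
Proof.
move=> n0; have n0' : 0 < n%:R :> R by rewrite ltr0n.
rewrite -(ler_pM2l n0') mulrDr.
have h : n%:R * logp n - \sum_(0 <= p < n.+1 | prime p) ln p%:R <= ln n`!%:R.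
  rewrite (@ln_fact_logn n n) // /logp mulr_sumr -sumrB.
  rewrite big_nat_cond [leRHS]big_nat_cond; apply: ler_sum => p /andP[/andP[_ pn] pp].
  have := @logn_fact_ge p n pp pn.
  move=> /(ler_wpM2r (ln_nat_ge0 p)) /(le_trans _); apply.
  by rewrite mulrBl mul1r mulrAC mulrA.
have := theta_le n; have := ln_fact_le n; lra.
Qed.

Lemma sum_ln_sq_le (n : nat) :
  \sum_(2 <= m < n.+1) ln m%:R / (m%:R * (m%:R - 1)) <= 1 + ln 2.
Proof.
(* The subtracted term is modelled on the tail integral of [ln t / t^2] and makes the induction
   telescope. *)
suff h k : \sum_(2 <= m < k.+2) ln m%:R / (m%:R * (m%:R - 1)) <=
    1 + ln 2 - (1 + ln k.+2%:R) / k.+1%:R.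
  case: n => [|n]; first by rewrite big_geq //; have := ln_nat_ge0 2; lra.
  apply: le_trans (h n) _; rewrite gerBl divr_ge0 //.
  by rewrite addr_ge0 // ln_nat_ge0.
elim: k => [|k IH]; first by rewrite big_geq // divr1 subrr.
rewrite big_nat_recr //=; apply: le_trans (lerD IH (lexx _)) _.
set m := k.+1%:R : R; have m0 : 0 < m by rewrite ltr0n.
have -> : k.+2%:R = m + 1 :> R by rewrite -[k.+2]addn1 natrD.
have -> : k.+3%:R = m + 2 :> R by rewrite -[k.+3]addn2 natrD.
have l1 : ln (m + 2) <= ln (m + 1) + (m + 1)^-1.
  rewrite -lerBlDl -ln_div ?posrE; [|lra..].
  have -> : (m + 2) / (m + 1) = 1 + (m + 1)^-1 by field; apply/eqP; lra.
  by apply: le_ln1Dx; apply: lt_trans (_ : 0 < _); [lra | rewrite invr_gt0; lra].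
have l2 : (1 + ln (m + 2)) / (m + 1) <= (1 + ln (m + 1) + (m + 1)^-1) / (m + 1).
  by rewrite ler_pM2r ?invr_gt0; lra.
rewrite -subr_ge0.
have -> : 1 + ln 2 - (1 + ln (m + 2)) / (m + 1) -
   (1 + ln 2 - (1 + ln (m + 1)) / m + ln (m + 1) / ((m + 1) * (m + 1 - 1)))
   = ((1 + ln (m + 1) + (m + 1)^-1) / (m + 1) - (1 + ln (m + 2)) / (m + 1))
     + (m * (m + 1) ^+ 2)^-1.
  by field; apply/andP; split; apply/eqP; lra.
apply: addr_ge0; first by rewrite subr_ge0.
by rewrite invr_ge0 mulr_ge0 ?exprn_ge0 //; lra.
Qed.

(** All powers of [p] together give [1/(p-1) = 1/p + 1/(p(p-1))]. The second part sums to at most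
    [1 + ln 2 <= 2], and [ln_fact_ge] costs another 1. *)
Lemma logp_ge (n : nat) : (0 < n)%N -> ln n%:R - 3 <= logp n.
Proof.
move=> n0; have n0' : 0 < n%:R :> R by rewrite ltr0n.
have h : ln n`!%:R <= n%:R * (logp n + (1 + ln 2)).
  rewrite (@ln_fact_logn n n) //.
  apply: (@le_trans _ _ (n%:R * \sum_(0 <= p < n.+1 | prime p)
     (ln p%:R / p%:R + ln p%:R / (p%:R * (p%:R - 1))))).
    rewrite mulr_sumr; apply: ler_sum => p pp.
    have p1 : 1 < p%:R :> R by rewrite ltr1n prime_gt1.
    apply: le_trans (ler_wpM2r (ln_nat_ge0 p) (logn_fact_le n pp)) _.
    rewrite le_eqVlt; apply/orP; left; apply/eqP; field.
    by apply/andP; split; apply/eqP; lra.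
  rewrite ler_pM2l // big_split /= lerD2l.
  apply: le_trans (sum_ln_sq_le n).
  rewrite big_mkcond /= (@big_cat_nat _ _ _ 2) //=.
  rewrite [X in X + _]big1_seq ?add0r; last first.
    by move=> i; rewrite mem_index_iota; case: i => [|[|]].
  rewrite big_nat_cond [leRHS]big_nat_cond.
  apply: ler_sum => p /andP[/andP[p2 _] _].
  case: ifP => // _; apply: divr_ge0; first exact: ln_nat_ge0.
  by rewrite mulr_ge0 // subr_ge0 ler1n; lia.
have := ln_fact_ge n => /le_trans /(_ h).
have -> : n%:R * ln n%:R - n%:R = n%:R * (ln n%:R - 1) by ring.
rewrite ler_pM2l //.
have : ln 2 <= 1 by have := @ln_le_subr1 2; lra.
lra.
Qed.

(** Partial summation in incremental form: from [n] to [n+1], the quantity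
    [recp n - logp n / ln n - ln (ln n)] moves by at most a constant times
    [1 / ln n - 1 / ln (n+1)], and these increments telescope to a bounded total. *)
Lemma recp_bound :
  exists2 c : R, 1 <= c & forall n, (2 <= n)%N ->
    `|recp n - ln (ln n%:R)| <= c.
Proof.
have l2 : 0 < ln 2 by rewrite ln_gt0 //; lra.
have l4 : 0 <= ln 4 by rewrite ln_ge0 //; lra.
pose K := ln 4 + 4 : R.
have bnd n : (2 <= n)%N -> `|recp n - logp n / ln n%:R - ln (ln n%:R)
     - (recp 2 - logp 2 / ln 2 - ln (ln 2))| <= K * ((ln 2)^-1 - (ln n%:R)^-1).
  elim: n => // n IH; rewrite leq_eqVlt => /predU1P[<-|n2].
    by rewrite !subrr normr0 mulr0.
  have {}IH := IH n2.
  have n0 : (0 < n)%N by lia.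
  have rE : recp n.+1 - recp n = (logp n.+1 - logp n) / ln n.+1%:R.
    rewrite /recp /logp big_mkcond big_nat_recr //= -big_mkcond /=.
    rewrite [X in (X - _) / _]big_mkcond big_nat_recr //= -big_mkcond /=.
    rewrite ![_ + _ - _]addrAC !subrr !add0r; case: ifP => _; last by rewrite mul0r.
    by rewrite mulrAC divff ?mul1r // gt_eqF // ln_gt0 // ltr1n; lia.
  have S1 := logp_le n0; have S2 := logp_ge n0.
  set a := ln n%:R in IH S1 S2 *; set b := ln n.+1%:R in rE *.
  have a0 : 0 < a by rewrite ln_gt0 // ltr1n.
  have ab : a <= b by rewrite ler_ln ?posrE ?ltr0n // ler_nat.
  have b0 : 0 < b by apply: lt_le_trans ab.
  have ba : b <= a + 1.
    have : b - a <= n.+1%:R / n%:R - 1.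
      rewrite -ln_div ?posrE ?ltr0n //; apply: ln_le_subr1.
      by rewrite divr_gt0 // ltr0n.
    have : n.+1%:R / n%:R <= 2 :> R.
      by rewrite ler_pdivrMr ?ltr0n // -natrM ler_nat; lia.
    lra.
  (* Tangent bounds enclose [ln b - ln a] between [(1/a - 1/b) a] and [(1/a - 1/b) b], while [S]
     equals [a] up to a constant. *)
  have u1 : ln b - ln a <= b / a - 1.
    by rewrite -ln_div ?posrE //; apply: ln_le_subr1; rewrite divr_gt0.
  have u2 : 1 - a / b <= ln b - ln a.
    have : ln a - ln b <= a / b - 1.
      by rewrite -ln_div ?posrE //; apply: ln_le_subr1; rewrite divr_gt0.
    lra.
  have iab : 0 <= a^-1 - b^-1 by rewrite subr_ge0 lef_pV2.
  set S := logp n in rE S1 S2 IH *; set S' := logp n.+1 in rE *.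
  have step : `|recp n.+1 - S' / b - ln b - (recp n - S / a - ln a)|
      <= K * (a^-1 - b^-1).
    have -> : recp n.+1 - S' / b - ln b - (recp n - S / a - ln a) =
       S * (a^-1 - b^-1) - (ln b - ln a).
      have -> : recp n.+1 = recp n + (S' - S) / b by rewrite -rE; lra.
      by lra.
    have e1 : (a^-1 - b^-1) * a = 1 - a / b by field; apply/andP; split; apply/eqP; lra.
    have e2 : (a^-1 - b^-1) * b = b / a - 1 by field; apply/andP; split; apply/eqP; lra.
    have m1 : (a^-1 - b^-1) * S <= (a^-1 - b^-1) * (a + ln 4) by exact: ler_wpM2l.
    have m2 : (a^-1 - b^-1) * (b - 4) <= (a^-1 - b^-1) * S.
      by apply: ler_wpM2l => //; lra.
    have m3 : 0 <= (a^-1 - b^-1) * ln 4 by exact: mulr_ge0.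
    rewrite ler_norml /K; apply/andP; split; lra.
  move: IH step; rewrite !ler_norml => /andP[i1 i2] /andP[s1 s2].
  by apply/andP; split; lra.
have iln n : (2 <= n)%N -> 0 <= (ln 2)^-1 - (ln n%:R)^-1 <= (ln 2)^-1.
  move=> n2; have ln2n : ln 2 <= ln n%:R.
    by rewrite ler_ln ?posrE ?ltr0n ?ler_nat //; lia.
  rewrite subr_ge0 lef_pV2 ?posrE ?ln2n //=; last exact: lt_le_trans ln2n.
  by rewrite gerBl invr_ge0 ln_nat_ge0.
pose D := `|recp 2 - logp 2 / ln 2 - ln (ln 2)|.
exists (D + K * (ln 2)^-1 + 4 + K / ln 2).
  have : 0 <= D by exact: normr_ge0.
  have : 0 <= K / ln 2 by rewrite divr_ge0 ?(ltW l2) // /K; lra.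
  lra.
move=> n n2; have n0 : (0 < n)%N by lia.
have /andP[i1 i2] := iln _ n2.
have a0 : 0 < ln n%:R by rewrite ln_gt0 // ltr1n.
have q1 : logp n / ln n%:R <= 1 + K / ln 2.
  rewrite ler_pdivrMr //; apply: le_trans (logp_le n0) _.
  rewrite mulrDl mul1r lerD2l.
  have : K / ln 2 * ln 2 <= K / ln 2 * ln n%:R.
    apply: ler_wpM2l; first by rewrite divr_ge0 ?(ltW l2) // /K; lra.
    by rewrite ler_ln ?posrE ?ltr0n ?ler_nat //; lia.
  rewrite divfK ?gt_eqF // /K; lra.
have q2 : 0 <= logp n / ln n%:R.
  apply: divr_ge0; last exact: ltW.
  by apply: sumr_ge0 => p _; rewrite divr_ge0 // ln_nat_ge0.
have := bnd _ n2.
have m1 : K * ((ln 2)^-1 - (ln n%:R)^-1) <= K * (ln 2)^-1.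
  by apply: ler_wpM2l => //; rewrite /K; lra.
have : `|recp 2 - logp 2 / ln 2 - ln (ln 2)| <= D by [].
rewrite !ler_norml => /andP[d1 d2] /andP[b1 b2].
by apply/andP; split; lra.
Qed.

End Mertens.

(** * The gcd sum as a positive quadratic form in the divisor sums *)

Section GcdForm.

Lemma sum_multiples (G : nat -> nat) (d e : nat) : (0 < e)%N ->
  (\sum_(0 <= i < d * e | e %| i) G i = \sum_(0 <= j < d) G (j * e))%N.
Proof.
move=> e0; elim: d => [|d IH]; first by rewrite mul0n !big_geq.
rewrite mulSn addnC (@big_cat_nat _ _ _ (d * e)) ?leq_addr //= IH.
rewrite [RHS]big_nat_recr //=; congr (_ + _)%N.
rewrite big_ltn_cond; last by rewrite -[ltnLHS]addn0 ltn_add2l.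
rewrite dvdn_mull // big_nat_cond big_pred0 ?addn0 // => i.
apply/negbTE; rewrite !negb_and -!orbA; apply/or3P.
have [ei|] := boolP (e %| i)%N; last by constructor 3.
have /dvdnP [q ->] := ei.
have [dq|qd] := ltnP d q.
  constructor 2; rewrite -leqNgt.
  by rewrite -{2}[e]mul1n -mulnDl addn1 leq_mul2r dq orbT.
by constructor 1; rewrite -leqNgt leq_mul2r qd orbT.
Qed.

(** Sort the residues [i < n] by [gcdn i n]: those with gcd [n / d] are counted by [totient d]. *)
Lemma sum_totient (n : nat) : (0 < n)%N ->
  (\sum_(0 <= d < n.+1 | d %| n) totient d = n)%N.
Proof.
move=> n0.
have tot d : (d %| n)%N ->
    totient d = (\sum_(0 <= i < n) (gcdn i n * d == n))%N.
  move=> dn; have d0 : (0 < d)%N by exact: dvdn_gt0 dn.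
  have /dvdnP[e ne] := dn; have e0 : (0 < e)%N by move: n0; rewrite ne muln_gt0 => /andP[].
  rewrite totient_count_coprime.
  under [RHS]eq_bigr => i _ do rewrite {2}ne eqn_pmul2r //.
  rewrite [RHS](bigID (fun i => e %| i)%N) /= [X in (_ + X)%N]big1 ?addn0; last first.
    by move=> i; apply: contraNeq; rewrite eqb0 negbK => /eqP <-; rewrite dvdn_gcdl.
  rewrite {1}ne mulnC sum_multiples //; apply: eq_bigr => j _.
  by rewrite ne mulnC -muln_gcdr -{2}[e]muln1 eqn_pmul2l // coprime_sym.
rewrite (eq_bigr _ tot) exchange_big /= -[RHS](subn0 n) -[RHS]muln1 -sum_nat_const_nat.
apply: eq_bigr => i _.
have g0 : (0 < gcdn i n)%N by rewrite gcdn_gt0 n0 orbT.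
have gn : (gcdn i n %| n)%N by exact: dvdn_gcdr.
rewrite big_mkcond (bigD1_seq (n %/ gcdn i n)%N) ?iota_uniq ?mem_index_iota //=; last first.
  by rewrite ltnS leq_div.
rewrite dvdn_div ?(mulnC (gcdn i n)) // divnK // eqxx big1 ?addn0 // => d nd.
case: ifP => // dn; apply/eqP; rewrite eqb0; apply: contra nd => /eqP gd.
by rewrite -{1}gd mulKn.
Qed.

Variable R : realType.

Definition mass (s : seq nat) : R := \sum_(n <- s) n%:R^-1.

Definition gform (s : seq nat) : R :=
  \sum_(n <- s) \sum_(m <- s) ((gcdn n m)%:R - 1) * (n%:R^-1 * m%:R^-1).

Lemma sum_seq_subset (T : eqType) (s t : seq T) (G : T -> R) :
  uniq s -> {subset s <= t} -> (forall x, x \in t -> 0 <= G x) ->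
  \sum_(x <- s) G x <= \sum_(x <- t) G x.
Proof.
elim: s t => [|x s IH] t /=.
  by move=> _ _ G0; rewrite big_nil big_seq sumr_ge0.
move=> /andP[xs us] st G0; rewrite big_cons.
have xt : x \in t by apply: st; rewrite mem_head.
rewrite (perm_big _ (perm_to_rem xt)) big_cons lerD2l.
apply: IH => // y ys; last by apply: G0; exact: mem_rem ys.
have := st y; rewrite inE ys orbT (perm_mem (perm_to_rem xt)) inE => /(_ isT).
by case/predU1P => // yx; rewrite yx (negPf xs) in ys.
Qed.

(** The divisor [d = 1] accounts for the subtracted 1. A cutoff [N] common to all pairs lets the sum
    over [d] be moved outside in [gformE]. *)
Lemma gcd_sub1E (n m N : nat) : (0 < n <= N)%N -> (0 < m)%N ->
  (gcdn n m)%:R - 1 =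
  \sum_(2 <= d < N.+1) (totient d)%:R * ((d %| n)%N%:R * (d %| m)%N%:R) :> R.
Proof.
move=> /andP[n0 nN] m0; have g0 : (0 < gcdn n m)%N by rewrite gcdn_gt0 n0.
have gN : (gcdn n m <= N)%N by rewrite (leq_trans _ nN) // dvdn_leq // dvdn_gcdl.
rewrite -{1}(sum_totient g0) natr_sum big_mkcond /=.
rewrite big_ltn // big_ltn //= ?dvd0n gtn_eqF // dvd1n add0r.
rewrite addrAC subrr add0r [in RHS](@big_cat_nat _ _ _ (gcdn n m).+1) //=.
rewrite [X in _ + X]big1_seq ?addr0; last first.
  move=> d /=; rewrite mem_index_iota => /andP[gd _].
  rewrite -natrM mulnb -dvdn_gcd gtnNdvd // ?mulr0 //.
apply: eq_bigr => d _; rewrite -natrM mulnb -dvdn_gcd.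
by case: ifP; rewrite ?mulr1 ?mulr0.
Qed.

Lemma gformE (s : seq nat) (N : nat) : all (fun n => (0 < n <= N)%N) s ->
  gform s = \sum_(2 <= d < N.+1)
    (totient d)%:R * (\sum_(n <- s | (d %| n)%N) n%:R^-1) ^+ 2.
Proof.
move=> sN.
transitivity (\sum_(n <- s) \sum_(m <- s) \sum_(2 <= d < N.+1)
   (totient d)%:R * (((d %| n)%N%:R * n%:R^-1) * ((d %| m)%N%:R * m%:R^-1)) : R).
  rewrite /gform big_seq [RHS]big_seq; apply: eq_bigr => n ns.
  rewrite big_seq [RHS]big_seq; apply: eq_bigr => m ms.
  have nN := allP sN _ ns; have /andP[m0 _] := allP sN _ ms.
  rewrite (gcd_sub1E nN m0) mulr_suml; apply: eq_bigr => d _; ring.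
under eq_bigr do rewrite exchange_big /=.
rewrite exchange_big /=; apply: eq_bigr => d _.
rewrite expr2 mulr_suml mulr_sumr [in RHS]big_mkcond /=; apply: eq_bigr => n _.
rewrite -mulr_sumr; case: (d %| n)%N; last first.
  by rewrite big1 ?mulr0 // => m _; rewrite !mul0r.
congr (_ * _); rewrite mulr_sumr [in RHS]big_mkcond /=; apply: eq_bigr => m _.
by case: (d %| m)%N; rewrite ?mul1r ?mul0r ?mulr0.
Qed.

(* Weighted Cauchy-Schwarz [(a + b)^2 <= (u + v) (a^2 / u + b^2 / v)] in each summand of
   [gformE]; it plays the role of the triangle inequality for the square root of [gform]. *)
Lemma gform_cat (s t : seq nat) (c u v : R) :
  all (ltn 0) s -> all (ltn 0) t -> 0 < u -> 0 < v ->
  gform s <= c * u ^+ 2 -> gform t <= c * v ^+ 2 ->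
  gform (s ++ t) <= c * (u + v) ^+ 2.
Proof.
move=> s0 t0 u0 v0.
pose N := (\max_(i <- s ++ t) i)%N.
have stN : all (fun n => (0 < n <= N)%N) (s ++ t).
  apply/allP => n nst; apply/andP; split; last exact: leq_bigmax_seq.
  by move: nst; rewrite mem_cat => /orP[/(allP s0)|/(allP t0)].
have := stN; rewrite all_cat => /andP[sN tN].
rewrite (gformE stN) (gformE sN) (gformE tN) => hs ht.
apply: (@le_trans _ _ ((u + v) * (u^-1 * (\sum_(2 <= d < N.+1)
    (totient d)%:R * (\sum_(n <- s | (d %| n)%N) n%:R^-1) ^+ 2) +
    v^-1 * (\sum_(2 <= d < N.+1)
    (totient d)%:R * (\sum_(n <- t | (d %| n)%N) n%:R^-1) ^+ 2)))).
  rewrite !mulr_sumr -big_split mulr_sumr /=; apply: ler_sum => d _.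
  rewrite big_cat /=; set a := \sum_(n <- s | _) _; set b := \sum_(n <- t | _) _.
  have -> : (u + v) * (u^-1 * ((totient d)%:R * a ^+ 2) +
      v^-1 * ((totient d)%:R * b ^+ 2)) =
     (totient d)%:R * ((a + b) ^+ 2 + (v * a - u * b) ^+ 2 / (u * v)).
    by field; rewrite !gt_eqF.
  by rewrite ler_wpM2l // lerDl divr_ge0 ?sqr_ge0 // mulr_ge0 // ltW.
have hs' : u^-1 * (\sum_(2 <= d < N.+1)
    (totient d)%:R * (\sum_(n <- s | (d %| n)%N) n%:R^-1) ^+ 2) <= c * u.
  by rewrite mulrC ler_pdivrMr // -mulrA -expr2.
have ht' : v^-1 * (\sum_(2 <= d < N.+1)
    (totient d)%:R * (\sum_(n <- t | (d %| n)%N) n%:R^-1) ^+ 2) <= c * v.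
  by rewrite mulrC ler_pdivrMr // -mulrA -expr2.
have uv : 0 <= u + v by lra.
apply: le_trans (ler_wpM2l uv (lerD hs' ht')) _.
by rewrite -mulrDr mulrCA expr2.
Qed.

Lemma gform_subset (s t : seq nat) : uniq s -> {subset s <= t} ->
  gform s <= gform t.
Proof.
move=> us st.
have G0 n m : 0 <= ((gcdn n m)%:R - 1) * (n%:R^-1 * m%:R^-1) :> R.
  (* For [m = 0] the weight vanishes because [0^-1 = 0]; otherwise the gcd is at least 1. *)
  have [->|m0] := posnP m; first by rewrite invr0 !mulr0.
  by rewrite mulr_ge0 // subr_ge0 ler1n gcdn_gt0 m0 orbT.
apply: (@le_trans _ _ (\sum_(n <- s) \sum_(m <- t)
    ((gcdn n m)%:R - 1) * (n%:R^-1 * m%:R^-1))).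
  by apply: ler_sum => n _; apply: sum_seq_subset.
by apply: sum_seq_subset => // n _; apply: sumr_ge0.
Qed.

(** Passage from sums over finite sets to sums over lists, in which all later estimates are made. *)
Lemma upto_seq (A : set nat) (x : R) : exists s : seq nat,
  [/\ uniq s, forall n, (n \in s) <-> (A n /\ n%:R <= x), logsum A x = mass s &
    (forall n, A n -> (0 < n)%N) -> 0 < mass s ->
      Egcd A x - 1 = gform s / mass s ^+ 2].
Proof.
exists (finmap.enum_fset (fset_set (upto A x))).
have LE : logsum A x = mass (finmap.enum_fset (fset_set (upto A x))).
  by rewrite /logsum fsbig_finite //; exact: finite_upto.
split=> //.
- exact: finmap.fset_uniq.
- move=> n; have := in_fset_set (finite_upto A x) n.
  by rewrite /= => nE; split=> [|nA]; [rewrite nE inE | rewrite nE inE].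
move=> A0 m0; rewrite /Egcd fsbig_finite /=; last exact: finite_upto.
under eq_bigr do rewrite (@fsbig_finite _ _ _ _ _ _ (finite_upto A x)) /=.
rewrite /logprob LE; set s := finmap.enum_fset _ in m0 *.
(* The subtracted 1 is the total mass of the product law, so it can be distributed over the
   pairs. *)
have one : 1 = (\sum_(n <- s) \sum_(m <- s) n%:R^-1 * m%:R^-1) / mass s ^+ 2.
  under eq_bigr do rewrite -mulr_sumr.
  by rewrite -mulr_suml -/(mass s) -expr2 divff // gt_eqF // exprn_gt0.
rewrite [X in _ - X]one -/(mass s) /gform !mulr_suml -sumrB; apply: eq_bigr => n _.
rewrite !mulr_suml -sumrB; apply: eq_bigr => m _.
by move: (n%:R^-1) (m%:R^-1) => a b; field; rewrite gt_eqF.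
Qed.

End GcdForm.

(** * Euler products, and the bound for the mass in terms of the gcd form *)

Section EulerProduct.
Variable R : realType.

(** Exponents are cut below [V], so that a multiplicative weight summed over the list is a finite
    product of finite sums. *)
Fixpoint smooth (V : nat) (P : seq nat) : seq nat :=
  if P is p :: P' then [seq (p ^ v * m)%N | v <- index_iota 0 V, m <- smooth V P']
  else [:: 1%N].

Definition omega (P : seq nat) (n : nat) : nat := count (dvdn^~ n) P.

Lemma coprime_smooth (p V : nat) (P : seq nat) : prime p -> all prime P ->
  p \notin P -> forall n, n \in smooth V P -> coprime p n.
Proof.
move=> pp; elim: P => [|q P IH] /=; first by move=> _ _ n; rewrite inE => /eqP->; rewrite coprimen1.
case/andP => qq Pp; rewrite inE negb_or => /andP[pq pP] n /allpairsP[[v m] /= [_ mP ->]].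
rewrite coprimeMr (IH Pp pP _ mP) andbT coprimeXr //.
by rewrite prime_coprime // dvdn_prime2.
Qed.

(** The cutoff loses no [n < V], since every exponent [logn p n] is below [n]. *)
Lemma mem_smooth (V : nat) (P : seq nat) (n : nat) : uniq P -> all prime P ->
  (0 < n < V)%N -> (forall q, prime q -> (q %| n)%N -> q \in P) -> n \in smooth V P.
Proof.
elim: P n => [|p P IH] n /= .
  move=> _ _ /andP[n0 nV] nP; rewrite inE eqn_leq n0 andbT leqNgt; apply/negP => n1.
  by have := nP _ (pdiv_prime n1) (pdiv_dvd n).
move=> /andP[pP uP] /andP[pp Pp] /andP[n0 nV] nP.
have [m cpm nE] := pfactor_coprime pp n0.
have m0 : (0 < m)%N by move: n0; rewrite nE muln_gt0 => /andP[].
apply/allpairsP; exists (logn p n, m); split => /=.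
- by rewrite mem_index_iota /= (ltn_trans _ nV) // ltn_logl.
- apply: IH => //.
    rewrite m0 (leq_ltn_trans _ nV) // nE leq_pmulr // expn_gt0 prime_gt0 //.
  move=> q qq qm; have : q \in p :: P by apply: nP => //; rewrite nE dvdn_mulr.
  rewrite inE => /predU1P[qp|//].
  by move: cpm; rewrite prime_coprime // -qp qm.
by rewrite mulnC.
Qed.

(** The weight is multiplicative, and [omega] counts [p] once whatever its exponent; so the factor
    of [p] is at most [1 + b sum_(v >= 1) p^(-v)]. *)
Lemma smooth_sum (b : R) (V : nat) (P : seq nat) : 0 <= b -> uniq P -> all prime P ->
  \sum_(n <- smooth V P) b ^+ omega P n * n%:R^-1
    <= \prod_(p <- P) (1 + b / (p%:R - 1)).
Proof.
move=> b0; elim: P => [|p P IH] /=.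
  by move=> _ _; rewrite big_nil big_seq1 mul1r invr1.
move=> /andP[pP uP] /andP[pp Pp]; rewrite big_allpairs_dep /= big_cons.
have p0 : 0 < p%:R :> R by rewrite ltr0n prime_gt0.
have -> : \sum_(0 <= v < V) \sum_(m <- smooth V P)
      b ^+ omega (p :: P) (p ^ v * m) * (p ^ v * m)%:R^-1 =
   (\sum_(0 <= v < V) b ^+ (0 < v)%N / p%:R ^+ v) *
   (\sum_(m <- smooth V P) b ^+ omega P m * m%:R^-1).
  rewrite mulr_suml; apply: eq_bigr => v _; rewrite mulr_sumr.
  rewrite big_seq [RHS]big_seq; apply: eq_bigr => m mP.
  have cpm := coprime_smooth pp Pp pP mP.
  have -> : omega (p :: P) (p ^ v * m) = ((0 < v) + omega P m)%N.
    rewrite /omega /=; congr (_ + _)%N.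
      rewrite Gauss_dvdl // Euclid_dvdX // dvdnn; by case: v.
    apply: eq_in_count => q qP; rewrite Gauss_dvdr //.
    rewrite coprimeXr // prime_coprime ?(allP Pp _ qP) //.
    by rewrite dvdn_prime2 ?(allP Pp _ qP) //; apply: contraNneq pP => <-.
  by rewrite exprD natrM natrX invfM; ring.
apply: ler_pM.
- by apply: sumr_ge0 => v _; rewrite mulr_ge0 ?exprn_ge0 // invr_ge0 exprn_ge0 // ltW.
- by apply: sumr_ge0 => m _; rewrite mulr_ge0 ?exprn_ge0.
- case: (V) => [|V']; first by rewrite big_geq // addr_ge0 // divr_ge0 // subr_ge0 ler1n prime_gt0.
  rewrite big_ltn //= expr0 invr1 mulr1 lerD2l big_nat_cond.
  rewrite (eq_bigr (fun v => b * (p%:R ^+ v)^-1)); last first.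
    by move=> v /andP[/andP[v0 _] _]; rewrite v0 expr1.
  by rewrite -big_nat_cond -mulr_sumr ler_wpM2l // geo_inv_le // prime_gt1.
exact: IH.
Qed.

Definition primes_upto (N : nat) : seq nat := [seq p <- index_iota 0 N.+1 | prime p].

Lemma primes_upto_prime (N : nat) : all prime (primes_upto N).
Proof. by apply/allP => p; rewrite mem_filter => /andP[]. Qed.

Lemma primes_upto_uniq (N : nat) : uniq (primes_upto N).
Proof. by rewrite filter_uniq // iota_uniq. Qed.

(** The differences [1/(m-1) - 1/m], summed over all integers [m > 1] in the range, telescope to at
    most 1. *)
Lemma sum_inv_pred_le (N : nat) :
  \sum_(p <- primes_upto N) (p%:R - 1)^-1 <= recp R N + 1.
Proof.
have -> : recp R N + 1 = \sum_(p <- primes_upto N) p%:R^-1 + 1 by rewrite big_filter.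
rewrite -lerBlDl -sumrB.
have h n : \sum_(2 <= m < n.+2) ((m%:R - 1)^-1 - m%:R^-1) = 1 - n.+1%:R^-1 :> R.
  elim: n => [|n IH]; first by rewrite big_geq // invr1 subrr.
  rewrite big_nat_recr //= IH -[n.+2]addn1 natrD addrK; ring.
apply: (@le_trans _ _ (\sum_(2 <= m < N.+2) ((m%:R - 1)^-1 - m%:R^-1))); last first.
  by rewrite h gerBl invr_ge0.
apply: sum_seq_subset; first exact: primes_upto_uniq.
  move=> p; rewrite mem_filter !mem_index_iota => /andP[pp /andP[_ pN]].
  by rewrite prime_gt1 // ltnW.
move=> m; rewrite mem_index_iota => /andP[m2 _].
have m1 : 1 < m%:R :> R by rewrite ltr1n.
by rewrite subr_ge0 lef_pV2 ?posrE; lra.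
Qed.

Lemma mass_le_of_gform (s : seq nat) (N : nat) (C0 M : R) :
  uniq s -> all (fun n => (0 < n <= N)%N) s -> 0 < mass R s -> 0 < C0 -> 1 <= M ->
  \sum_(p <- primes_upto N) (p%:R - 1)^-1 <= M ->
  gform R s <= C0 ^+ 2 * mass R s ^+ 2 ->
  mass R s <= expR (C0 * Num.sqrt M * ln M + 1).
Proof.
move=> us sN L0 C00 M1 PM; rewrite (gformE R sN) => gs.
set L := mass R s in L0 gs *; set P := primes_upto N in PM *.
have M0 : 0 < M by lra.
set q := Num.sqrt M; have q0 : 0 < q by rewrite sqrtr_gt0.
have qM : q ^+ 2 = M by rewrite sqr_sqrtr // ltW.
pose S p : R := \sum_(n <- s | (p %| n)%N) n%:R^-1.
have pP p : p \in P -> prime p by move=> /(allP (primes_upto_prime N)).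
have W_le : \sum_(n <- s) (omega P n)%:R * n%:R^-1 <= C0 * q * L.
  have -> : \sum_(n <- s) (omega P n)%:R * n%:R^-1 = \sum_(p <- P) S p.
    under eq_bigr => n _ do rewrite /omega -sum1_count natr_sum mulr_suml.
    under eq_bigr => n _ do rewrite big_mkcond /=.
    rewrite exchange_big /=; apply: eq_bigr => p _; rewrite /S [RHS]big_mkcond /=.
    by apply: eq_bigr => n _; case: ifP => //; rewrite mul1r.
  (* Cauchy-Schwarz in the form [2 S <= t (p-1) S^2 + 1 / (t (p-1))]; this [t] makes each of the two
     resulting sums at most [C0 q L]. *)
  pose t := q / (C0 * L); have t0 : 0 < t by rewrite divr_gt0 // mulr_gt0.
  apply: (@le_trans _ _ (2^-1 * (t * \sum_(p <- P) (p%:R - 1) * S p ^+ 2 +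
     t^-1 * \sum_(p <- P) (p%:R - 1)^-1))).
    rewrite !mulr_sumr -big_split mulr_sumr /= big_seq [leRHS]big_seq.
    apply: ler_sum => p /pP pp.
    have p1 : 0 < p%:R - 1 :> R by rewrite subr_gt0 ltr1n prime_gt1.
    rewrite -subr_ge0.
    have -> : 2^-1 * (t * ((p%:R - 1) * S p ^+ 2) + t^-1 * (p%:R - 1)^-1) - S p =
       (t * (p%:R - 1) * S p - 1) ^+ 2 / (2 * t * (p%:R - 1)).
      by field; rewrite !gt_eqF.
    by rewrite divr_ge0 ?sqr_ge0 // mulr_ge0 ?(ltW p1) // mulr_ge0 ?(ltW t0).
  have G1 : \sum_(p <- P) (p%:R - 1) * S p ^+ 2 <= C0 ^+ 2 * L ^+ 2.
    apply: le_trans gs; apply: (@le_trans _ _ (\sum_(p <- P) (totient p)%:R * S p ^+ 2)).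
      rewrite big_seq [leRHS]big_seq; apply: ler_sum => p /pP pp.
      by rewrite totient_prime // -subn1 natrB // prime_gt0.
    apply: sum_seq_subset; first exact: primes_upto_uniq.
      move=> p; rewrite mem_filter !mem_index_iota => /andP[pp /andP[_ pN]].
      by rewrite prime_gt1.
    by move=> d _; rewrite mulr_ge0 // sqr_ge0.
  have := ler_wpM2l (ltW t0) G1.
  have ti0 : 0 <= t^-1 by rewrite invr_ge0 ltW.
  have := ler_wpM2l ti0 PM.
  have -> : t * (C0 ^+ 2 * L ^+ 2) = C0 * q * L by rewrite /t; field; rewrite !gt_eqF.
  have -> : t^-1 * M = C0 * q * L by rewrite /t -qM; field; rewrite !gt_eqF.
  lra.
pose b := ln M; have b0 : 0 <= b by rewrite ln_ge0.
(* Jensen's inequality, through the tangent of [exp (- b t)] at [t = C0 q]. *)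
have low : expR (- (b * (C0 * q))) * L <= \sum_(n <- s) M^-1 ^+ omega P n * n%:R^-1.
  apply: (@le_trans _ _ (expR (- (b * (C0 * q))) *
      \sum_(n <- s) (1 - b * ((omega P n)%:R - C0 * q)) * n%:R^-1)).
    rewrite ler_wpM2l ?expR_ge0 //.
    have -> : \sum_(n <- s) (1 - b * ((omega P n)%:R - C0 * q)) * n%:R^-1 =
      (1 + b * (C0 * q)) * L - b * \sum_(n <- s) (omega P n)%:R * n%:R^-1.
      by rewrite /L /mass !mulr_sumr -sumrB; apply: eq_bigr => n _; ring.
    have := ler_wpM2l b0 W_le; lra.
  rewrite mulr_sumr; apply: ler_sum => n _; rewrite [leLHS]mulrA; apply: ler_wpM2r => //.
  have -> : M^-1 ^+ omega P n =
     expR (- (b * (C0 * q))) * expR (- (b * ((omega P n)%:R - C0 * q))).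
    rewrite -expRD -[X in X^-1](lnK M0) -expRN -expRM_natl; congr expR.
    rewrite -/b -mulr_natl; ring.
  by rewrite ler_wpM2l ?expR_ge0 // expR_ge1Dx.
(* With weight [1 / M] per prime factor, the Euler product is at most the exponential of [M^-1]
   times the sum of [1/(p-1)], and that sum is at most [M]. *)
have up : \sum_(n <- s) M^-1 ^+ omega P n * n%:R^-1 <= expR 1.
  have Mi0 : 0 <= M^-1 by rewrite invr_ge0 ltW.
  apply: (@le_trans _ _ (\sum_(n <- smooth N.+1 P) M^-1 ^+ omega P n * n%:R^-1)).
    apply: sum_seq_subset => //; last by move=> n _; rewrite mulr_ge0 // exprn_ge0.
    move=> n ns; apply: mem_smooth => //; [exact: primes_upto_uniq | exact: primes_upto_prime | exact: (allP sN) |].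
    move=> r pr rn; rewrite mem_filter pr mem_index_iota /= ltnS.
    have /andP[n0 nN] := allP sN _ ns; exact: leq_trans (dvdn_leq n0 rn) nN.
  apply: le_trans (smooth_sum _ Mi0 (primes_upto_uniq N) (primes_upto_prime N)) _.
  apply: (@le_trans _ _ (expR (M^-1 * \sum_(p <- P) (p%:R - 1)^-1))).
    rewrite mulr_sumr expR_sum big_seq [leRHS]big_seq; apply: ler_prod => p /pP pp.
    have p1 : 0 < p%:R - 1 :> R by rewrite subr_gt0 ltr1n prime_gt1.
    by rewrite addr_ge0 ?divr_ge0 ?(ltW p1) //= expR_ge1Dx.
  by rewrite ler_expR -ler_pdivlMl ?invr_gt0 // invrK mulr1.
have := le_trans low up; rewrite expRN ler_pdivrMl ?expR_gt0 // -expRD => h.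
by apply: le_trans h _; rewrite ler_expR /b mulrC.
Qed.

End EulerProduct.

(** * Part (ii): the upper bound for the logarithmic sum *)

Section UpperPart.
Variable R : realType.

(** Rounding [y] down to [n >= 2] changes [ln ln] by at most [ln 2], because [y < n + 1 <= n^2]. *)
Lemma recp_bound_real :
  exists2 c : R, 1 <= c & forall y, 2 <= y ->
    `|recp R (Num.truncn y) - ln (ln y)| <= c.
Proof.
have [c c1 Hc] := recp_bound R.
exists (c + ln 2); first by have := ln_nat_ge0 R 2; lra.
move=> y y2; have y0 : 0 <= y by lra.
set n := Num.truncn y.
have n2 : (2 <= n)%N by rewrite truncn_ge_nat.
have ny : n%:R <= y by rewrite truncn_le.
have yn : y < n.+1%:R by rewrite truncnS_gt.
have n0 : 0 < n%:R :> R by rewrite ltr0n; lia.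
have l0 : 0 < ln n%:R :> R by rewrite ln_gt0 // ltr1n.
have l1 : ln n%:R <= ln y by rewrite ler_ln ?posrE //; lra.
have l2 : ln y <= 2 * ln n%:R.
  rewrite mulr_natl -lnXn // ler_ln ?posrE ?exprn_gt0 //; last by lra.
  by apply: le_trans (ltW yn) _; rewrite -natrX ler_nat; nia.
have ll1 : ln (ln n%:R) <= ln (ln y) by rewrite ler_ln ?posrE //; lra.
have ll2 : ln (ln y) <= ln 2 + ln (ln n%:R).
  by rewrite -lnM ?posrE // ler_ln ?posrE //; [lra|rewrite mulr_gt0].
have := Hc _ n2; rewrite !ler_norml => /andP[h1 h2].
have := ln_nat_ge0 R 2.
by move=> ?; apply/andP; split; lra.
Qed.

Lemma Log_ge1 (x : R) : 1 <= Log x.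
Proof. by rewrite /Log le_max lexx orbT. Qed.

Lemma Log2_cvgy : Log2 x @[x --> (+oo : set_system R)] --> +oo.
Proof.
apply/cvgryPge => A; near=> x.
have xA : expR (expR A) <= x by near: x; apply: nbhs_pinfty_ge; rewrite num_real.
have l1 : expR A <= ln x by rewrite -[leLHS]expRK ler_ln ?posrE ?expR_gt0 // (lt_le_trans _ xA) ?expR_gt0.
have l2 : expR A <= Log x by rewrite /Log le_max l1.
rewrite /Log2 {1}/Log le_max; apply/orP; left.
by rewrite -[leLHS]expRK ler_ln ?posrE ?expR_gt0 // (lt_le_trans _ l2) ?expR_gt0.
Unshelve. all: by end_near. Qed.

Lemma logsum_upper_bound (C0 : R) : 0 < C0 ->
  exists2 o : R -> R, o x @[x --> +oo] --> (0 : R) &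
    \forall x \near +oo,
      forall A : set nat,
        (forall n, A n -> (0 < n)%N) ->
        upto A x !=set0 ->
        Egcd A x - 1 <= C0 ^+ 2 ->
        logsum A x <= expR ((C0 + o x) * Num.sqrt (Log2 x) * Log3 x).
Proof.
move=> C00; have [c0 c01 Hc] := recp_bound_real.
pose c := c0 + 1.
(* With [u = c / Log2 x], the first term absorbs a factor [1 + u] from the square root and another
   from the logarithm; the second absorbs the additive 1 in the exponent of [mass_le_of_gform]. *)
pose o x := C0 * ((1 + c * (Log2 x)^-1) ^+ 2 - 1) + Num.sqrt ((Log2 x)^-1).
have inv0 : (Log2 x)^-1 @[x --> +oo] --> (0 : R).
  apply/gtr0_cvgV0; last exact: Log2_cvgy.
  by near=> x; apply: lt_le_trans (Log_ge1 _).
exists o.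
  have -> : (0 : R) = C0 * ((1 + c * 0) ^+ 2 - 1) + Num.sqrt 0.
    by rewrite mulr0 addr0 expr1n subrr mulr0 sqrtr0 addr0.
  apply: cvgD; last by apply: (cvg_comp _ _ inv0); exact: sqrt_continuous.
  apply: cvgM; first exact: cvg_cst.
  apply: cvgB; last exact: cvg_cst.
  rewrite expr2; under eq_fun do rewrite expr2.
  by apply: cvgM; apply: cvgD; (try exact: cvg_cst); apply: cvgM => //; exact: cvg_cst.
near=> x => A A0 [n0 [An0 n0x]].
have x3 : 3 <= x by near: x; apply: nbhs_pinfty_ge; rewrite num_real.
have [s [us sA LE EE]] := upto_seq A x; rewrite LE.
set N := Num.truncn x.
have x0 : 0 <= x by lra.
have sN : all (fun n => (0 < n <= N)%N) s.
  by apply/allP => n /sA[An nx]; rewrite A0 // truncn_ge_nat.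
have L0 : 0 < mass R s.
  have n0s : n0 \in s by apply/sA.
  have -> : mass R s = n0%:R^-1 + mass R (rem n0 s).
    by rewrite /mass (perm_big _ (perm_to_rem n0s)) big_cons.
  rewrite ltr_wpDr //; first by apply: sumr_ge0.
  by rewrite invr_gt0 ltr0n A0.
rewrite EE // ler_pdivrMr ?exprn_gt0 // => gs.
set l := Log2 x; have l1 : 1 <= l by exact: Log_ge1.
have c2 : 2 <= c by rewrite /c; lra.
(* This makes [Log x] equal to [ln x], whence [ln (ln x) <= Log2 x]. *)
have lnx : 1 < ln x.
  have ex : expR 1 < x by near: x; apply: nbhs_pinfty_gt; rewrite num_real.
  have xpos : 0 < x by lra.
  have : ln (expR 1) < ln x by rewrite ltr_ln ?posrE ?expR_gt0.
  by rewrite expRK.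
have M_le : \sum_(p <- primes_upto N) (p%:R - 1)^-1 <= l + c.
  apply: le_trans (sum_inv_pred_le R N) _; rewrite /c.
  have := Hc x; rewrite ler_norml => /(_ _)/andP[|_]; first by lra.
  have : ln (ln x) <= l.
    by rewrite /l /Log2 {1}/Log le_max; apply/orP; left; rewrite /Log max_l // ltW.
  lra.
have M1 : 1 <= l + c by lra.
apply: le_trans (mass_le_of_gform us sN L0 C00 M1 M_le gs) _.
rewrite ler_expR.
set u := c * l^-1.
have l0 : 0 < l by lra.
have u0 : 0 <= u by rewrite mulr_ge0 ?invr_ge0; lra.
have lE : l + c = l * (1 + u) by rewrite /u; field; rewrite gt_eqF.
have sq : Num.sqrt (l + c) <= Num.sqrt l * (1 + u).
  rewrite lE sqrtrM; last by lra.
  apply: ler_wpM2l; first exact: sqrtr_ge0.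
  rewrite -[leRHS]ger0_norm; last by lra.
  rewrite -sqrtr_sqr ler_wsqrtr // expr2 ler_peMr; lra.
have L3 : 1 <= Log3 x by exact: Log_ge1.
have lnl : ln (l + c) <= Log3 x * (1 + u).
  rewrite lE lnM ?posrE //; last by lra.
  have : ln (1 + u) <= u by apply: le_ln1Dx; lra.
  have : ln l <= Log3 x by rewrite /Log3 -/(Log2 x) -/l {1}/Log le_max lexx.
  have : u <= Log3 x * u by rewrite ler_peMl.
  lra.
have sl1 : 1 <= Num.sqrt l * Num.sqrt (l^-1).
  by rewrite -sqrtrM ?divff ?sqrtr1 ?gt_eqF // ltW.
have prod : Num.sqrt (l + c) * ln (l + c) <= Num.sqrt l * (1 + u) * (Log3 x * (1 + u)).
  by apply: ler_pM; rewrite ?sqrtr_ge0 ?ln_ge0.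
have := ler_wpM2l (ltW C00) prod.
have : 1 <= Num.sqrt l * Num.sqrt (l^-1) * Log3 x by rewrite -[leLHS]mulr1 ler_pM.
rewrite /o -/l -/u mulrA.
have -> : (C0 + (C0 * ((1 + u) ^+ 2 - 1) + Num.sqrt l^-1)) * Num.sqrt l * Log3 x =
   C0 * (Num.sqrt l * (1 + u) * (Log3 x * (1 + u))) +
     Num.sqrt l * Num.sqrt l^-1 * Log3 x by ring.
lra.
Unshelve. all: by end_near. Qed.

End UpperPart.

(** * Products of distinct primes, their symmetric sums and their overlaps *)

Section SquarefreeProducts.
Variable R : realType.

(** One product for each choice of [r] positions in [s]; the recursion decides whether the head is
    used. For distinct primes these are the squarefree numbers with exactly [r] prime factors, all
    in [s]. *)
Fixpoint sqf (s : seq nat) (r : nat) : seq nat :=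
  if r is r'.+1 then
    (if s is p :: s' then sqf s' r'.+1 ++ [seq (p * n)%N | n <- sqf s' r'] else [::])
  else [:: 1%N].

Lemma sqf0 s : sqf s 0 = [:: 1%N].
Proof. by case: s. Qed.

(* Elementary symmetric polynomials in the reciprocals of the entries of [s]. *)
Definition esym (s : seq nat) (r : nat) : R := mass R (sqf s r).

Lemma esym0 s : esym s 0 = 1.
Proof. by case: s => [|p s]; rewrite /esym /mass big_seq1 invr1. Qed.

Lemma esym_nil r : esym [::] r.+1 = 0.
Proof. by rewrite /esym /mass big_nil. Qed.

Lemma esym_cons p s r : esym (p :: s) r.+1 = esym s r.+1 + p%:R^-1 * esym s r.
Proof.
rewrite /esym /mass big_cat big_map /= mulr_sumr; congr (_ + _).
by apply: eq_bigr => n _; rewrite natrM invfM.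
Qed.

Lemma mass_cons p s : mass R (p :: s) = p%:R^-1 + mass R s.
Proof. by rewrite /mass big_cons. Qed.

Lemma mass_ge0 s : 0 <= mass R s.
Proof. exact: sumr_ge0. Qed.

Lemma esym_ge0 s r : 0 <= esym s r.
Proof. exact: mass_ge0. Qed.

Lemma esym1 s : esym s 1 = mass R s.
Proof.
elim: s => [|p s IH]; first by rewrite esym_nil /mass big_nil.
by rewrite esym_cons IH esym0 mulr1 mass_cons addrC.
Qed.

(** Expanding [mass s * esym s r] produces every product of [r + 1] distinct entries [r + 1] times,
    and nonnegative terms with a repeated entry. *)
Lemma esym_succ_le s r : r.+1%:R * esym s r.+1 <= mass R s * esym s r.
Proof.
elim: s r => [|p s IH] [|r].
- by rewrite esym_nil esym0 mulr0 mulr1 mass_ge0.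
- by rewrite !esym_nil !mulr0.
- by rewrite esym1 esym0 mul1r mulr1.
rewrite !esym_cons mass_cons.
have w0 : 0 <= p%:R^-1 :> R by [].
move: (p%:R^-1) w0 => w w0.
have := IH r.+1; have := ler_wpM2l w0 (IH r).
have : 0 <= w * w * esym s r by rewrite !mulr_ge0 // esym_ge0.
rewrite -[r.+2]addn1 natrD -[r.+1]addn1 natrD.
have := esym_ge0 s r; have := mass_ge0 s.
set e0 := esym s r; set e1 := esym s (r + 1); set e2 := esym s (r + 1 + 1).
lra.
Qed.

(** A term with a repeated entry is a term of [esym s r] times the reciprocal of one of its [r]
    entries, so these terms total at most [r t esym s r]. *)
Lemma esym_succ_ge (t : R) s r : 0 <= t ->
  {in s, forall p, p%:R^-1 <= t} ->
  (mass R s - r%:R * t) * esym s r <= r.+1%:R * esym s r.+1.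
Proof.
move=> t0; elim: s r => [|p s IH] [|r] st.
- by rewrite esym_nil esym0 /mass big_nil; lra.
- by rewrite !esym_nil !mulr0.
- by rewrite esym1 esym0 mul0r subr0 mul1r mulr1.
rewrite !esym_cons mass_cons.
have w0 : 0 <= p%:R^-1 :> R by [].
have wt : p%:R^-1 <= t by apply: st; rewrite mem_head.
have {}IH k := IH k (fun q qs => st q (mem_behead (s := p :: s) qs)).
move: (p%:R^-1) w0 wt => w w0 wt.
have := IH r.+1; have := ler_wpM2l w0 (IH r).
have : 0 <= w * (t - w) * esym s r.
  by apply: mulr_ge0; [apply: mulr_ge0 => //; lra | exact: esym_ge0].
rewrite -[r.+2]addn1 natrD -[r.+1]addn1 natrD.
set e0 := esym s r; set e1 := esym s (r + 1); set e2 := esym s (r + 1 + 1).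
lra.
Qed.

Lemma esym_le s r : esym s r <= mass R s ^+ r / r`!%:R.
Proof.
elim: r => [|r IH]; first by rewrite esym0 expr0 fact0 invr1 mulr1.
rewrite ler_pdivlMr ?ltr0n ?fact_gt0 // factS natrM mulrCA mulrA.
move: IH; rewrite ler_pdivlMr ?ltr0n ?fact_gt0 // => IH.
apply: (@le_trans _ _ (mass R s * esym s r * r`!%:R)).
  by rewrite ler_wpM2r // esym_succ_le.
by rewrite -mulrA exprS ler_wpM2l // mass_ge0.
Qed.

Section LowerBound.
Variables (s : seq nat) (t M : R) (K : nat).
Hypotheses (t0 : 0 <= t) (M0 : 0 <= M) (MK : M <= mass R s - K%:R * t).
Hypothesis st : {in s, forall p, p%:R^-1 <= t}.

(** [M] bounds [mass s - r t] from below for all [r <= K] at once, so the step can be iterated with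
    a constant factor. *)
Lemma esym_step r : (r <= K)%N -> M * esym s r <= r.+1%:R * esym s r.+1.
Proof.
move=> rK; apply: le_trans (esym_succ_ge r t0 st).
apply: ler_wpM2r; first exact: esym_ge0.
apply: le_trans MK _; rewrite lerD2l lerN2; apply: ler_wpM2r => //.
by rewrite ler_nat.
Qed.

Lemma esym_ge r : (r <= K)%N -> M ^+ r / r`!%:R <= esym s r.
Proof.
elim: r => [|r IH] rK; first by rewrite esym0 expr0 fact0 invr1 mulr1.
rewrite ler_pdivrMr ?ltr0n ?fact_gt0 // factS natrM [leRHS]mulrCA mulrA.
have := IH (ltnW rK); rewrite ler_pdivrMr ?ltr0n ?fact_gt0 // => {}IH.
apply: (@le_trans _ _ (M * esym s r * r`!%:R)).
  by rewrite -mulrA exprS ler_wpM2l.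
apply: ler_wpM2r => //; exact: esym_step (ltnW rK).
Qed.

(** Each step down in degree costs a factor at most [r / M]. In [ovl_le_exp] this bounds the
    cofactors that remain once [l] shared primes are removed. *)
Lemma esym_sub_le r l : (r <= K)%N -> (l <= r)%N ->
  M ^+ l * esym s (r - l) <= r%:R ^+ l * esym s r.
Proof.
move=> rK; elim: l => [|l IH] lr; first by rewrite subn0 !expr0.
have {}IH := IH (ltnW lr).
have e : (r - l = (r - l.+1).+1)%N by lia.
have h : M * esym s (r - l.+1) <= r%:R * esym s (r - l).
  apply: le_trans (esym_step _) _; first by lia.
  by rewrite -e; apply: ler_wpM2r; [exact: esym_ge0 | rewrite ler_nat leq_subr].
rewrite exprSr -mulrA; apply: (@le_trans _ _ (M ^+ l * (r%:R * esym s (r - l)))).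
  by apply: ler_wpM2l => //; exact: exprn_ge0.
by rewrite mulrCA [r%:R ^+ l.+1]exprS -mulrA ler_wpM2l.
Qed.

End LowerBound.

Lemma sqf_gt0 s r n : all prime s -> n \in sqf s r -> (0 < n)%N.
Proof.
elim: s r n => [|p s IH] [|r] n //=; try by rewrite inE => _ /eqP->.
move=> /andP[pp sp]; rewrite mem_cat => /orP[|/mapP[m ms ->]]; first exact: IH.
by rewrite muln_gt0 prime_gt0 //= (IH r).
Qed.

Lemma coprime_sqf m s r n : {in s, forall p, coprime m p} -> n \in sqf s r ->
  coprime m n.
Proof.
elim: s r n => [|p s IH] [|r] n //= cs; try by rewrite inE => /eqP->; rewrite coprimen1.
have cs' : {in s, forall q, coprime m q} by move=> q qs; apply: cs; rewrite inE qs orbT.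
rewrite mem_cat => /orP[|/mapP[k ks ->]]; first exact: IH.
by rewrite coprimeMr cs ?mem_head // (IH r).
Qed.

Lemma coprime_prime_sqf p s r n : prime p -> all prime s -> p \notin s ->
  n \in sqf s r -> coprime p n.
Proof.
move=> pp sp ps; apply: coprime_sqf => q qs.
rewrite prime_coprime // dvdn_prime2 ?(allP sp _ qs) //.
by apply: contraNneq ps => ->.
Qed.

Lemma sqf_uniq s r : uniq s -> all prime s -> uniq (sqf s r).
Proof.
elim: s r => [|p s IH] [|r] //= /andP[ps us] /andP[pp sp].
rewrite cat_uniq IH //= map_inj_in_uniq ?IH ?andbT //; last first.
  by move=> x y _ _ /eqP; rewrite eqn_pmul2l ?prime_gt0 // => /eqP.
apply/hasPn => _ /mapP[m ms ->] /=; apply/negP => pm.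
have := coprime_prime_sqf pp sp ps pm.
by rewrite prime_coprime // dvdn_mulr.
Qed.

Lemma sqf_le s r n (y : R) : 0 <= y -> {in s, forall p, p%:R <= y} ->
  n \in sqf s r -> n%:R <= y ^+ r.
Proof.
move=> y0; elim: s r n => [|p s IH] [|r] n //= sy; try by rewrite inE => /eqP->; rewrite expr0.
have sy' : {in s, forall q, q%:R <= y} by move=> q qs; apply: sy; rewrite inE qs orbT.
rewrite mem_cat => /orP[|/mapP[k ks ->]]; first exact: IH.
by rewrite natrM exprS ler_pM // ?sy ?mem_head // IH.
Qed.

(** If a product of primes is at most [z], so is each of its factors. *)
Lemma sqf_ge_entry s r n (z : R) : all prime s -> n \in sqf s r -> n%:R <= z ->
  n \in sqf [seq p <- s | p%:R <= z] r.
Proof.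
move=> + + nz; elim: s r n nz => [|p s IH] [|r] n nz //=; first by rewrite sqf0.
move=> /andP[pp sp]; rewrite mem_cat => /orP[ns|/mapP[k ks nE]].
  by case: ifP => _ /=; [rewrite mem_cat IH | rewrite IH].
have k0 := sqf_gt0 sp ks; have p0 := prime_gt0 pp.
have pz : p%:R <= z by apply: le_trans nz; rewrite nE ler_nat leq_pmulr.
have kz : k%:R <= z by apply: le_trans nz; rewrite nE ler_nat leq_pmull.
by rewrite pz /= mem_cat nE map_f ?orbT // IH.
Qed.

Lemma sqf_subset s s' r : subseq s s' -> {subset sqf s r <= sqf s' r}.
Proof.
elim: s' s r => [|p s' IH] [|q s] r //; [by move=> _ n | by case: r => // _ n | ].
case: r => [|r]; [by move=> _ n | move=> /=; case: eqP => [->|_] ss n].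
  rewrite !mem_cat => /orP[ns|/mapP[k ks ->]]; first by rewrite (IH s).
  by rewrite map_f ?orbT // (IH s).
by move=> ns; rewrite mem_cat (IH (q :: s)).
Qed.

(** The degrees [r] and [r'] are independent because removing a prime from one side only, as in
    [ovl_cons], makes them differ. *)
Definition ovl (s : seq nat) (r r' : nat) : R :=
  \sum_(n <- sqf s r) \sum_(m <- sqf s r') (gcdn n m)%:R * (n%:R^-1 * m%:R^-1).

(** Sort the pairs by which of [n], [m] contain [p]. If both do, the gcd gains a factor [p], which
    cancels one of the two [1/p]; so all three cases carry the same weight. *)
Lemma ovl_cons p s r r' : prime p -> all prime s -> p \notin s ->
  ovl (p :: s) r.+1 r'.+1 = ovl s r.+1 r'.+1 +
    p%:R^-1 * (ovl s r r'.+1 + ovl s r.+1 r' + ovl s r r').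
Proof.
move=> pp sp ps; rewrite /ovl /= !big_cat /= !big_map.
have p0 : p%:R != 0 :> R by rewrite pnatr_eq0 -lt0n prime_gt0.
under eq_bigr => n _ do rewrite big_cat /= big_map.
under [X in _ + X]eq_bigr => n _ do rewrite big_cat /= big_map.
rewrite !big_split /= !mulrDr !mulr_sumr.
have e1 : \sum_(n <- sqf s r.+1) \sum_(m <- sqf s r')
    (gcdn n (p * m))%:R * (n%:R^-1 * (p * m)%:R^-1) =
   \sum_(n <- sqf s r.+1) p%:R^-1 * \sum_(m <- sqf s r')
    (gcdn n m)%:R * (n%:R^-1 * m%:R^-1) :> R.
  rewrite big_seq [RHS]big_seq; apply: eq_bigr => n ns; rewrite mulr_sumr.
  apply: eq_bigr => m _; rewrite Gauss_gcdr; last first.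
    by rewrite coprime_sym; exact: coprime_prime_sqf ns.
  by rewrite natrM invfM; ring.
have e2 : \sum_(n <- sqf s r) \sum_(m <- sqf s r'.+1)
    (gcdn (p * n) m)%:R * ((p * n)%:R^-1 * m%:R^-1) =
   \sum_(n <- sqf s r) p%:R^-1 * \sum_(m <- sqf s r'.+1)
    (gcdn n m)%:R * (n%:R^-1 * m%:R^-1) :> R.
  apply: eq_bigr => n _; rewrite mulr_sumr.
  rewrite big_seq [RHS]big_seq; apply: eq_bigr => m ms.
  rewrite gcdnC Gauss_gcdr; last first.
    by rewrite coprime_sym; exact: coprime_prime_sqf ms.
  by rewrite natrM invfM gcdnC; ring.
have e3 : \sum_(n <- sqf s r) \sum_(m <- sqf s r')
    (gcdn (p * n) (p * m))%:R * ((p * n)%:R^-1 * (p * m)%:R^-1) =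
   \sum_(n <- sqf s r) p%:R^-1 * \sum_(m <- sqf s r')
    (gcdn n m)%:R * (n%:R^-1 * m%:R^-1) :> R.
  apply: eq_bigr => n _; rewrite mulr_sumr; apply: eq_bigr => m _.
  rewrite -muln_gcdr !natrM !invfM.
  by move: (n%:R^-1) (m%:R^-1) => u v; field.
rewrite e1 e2 e3; ring.
Qed.

(* [esym s (r - l)] without the truncation of the subtraction. *)
Definition esymB (s : seq nat) (r l : nat) : R := if (l <= r)%N then esym s (r - l) else 0.

Lemma esymB_ge0 s r l : 0 <= esymB s r l.
Proof. by rewrite /esymB; case: ifP => // _; exact: esym_ge0. Qed.

Lemma esymB0 s r : esymB s r 0 = esym s r.
Proof. by rewrite /esymB subn0. Qed.

Lemma esymB_cons p s r l :
  esymB (p :: s) r.+1 l = esymB s r.+1 l + p%:R^-1 * esymB s r l.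
Proof.
rewrite /esymB; case: (ltngtP l r.+1) => [lr|lr|->].
- by rewrite -ltnS lr subSn // esym_cons.
- by rewrite leqNgt ltnW // mulr0 addr0.
- by rewrite subnn !esym0 ltnn mulr0 addr0.
Qed.

(* Both sides are coefficients of [u^r v^r']: of [prod (1 + (u + v + u v) / p)] on the left
   and of [prod (1 + u / p) (1 + v / p) (1 + u v / p)] on the right. *)
Lemma ovl_le s r r' K : uniq s -> all prime s -> (r < K)%N ->
  ovl s r r' <= \sum_(0 <= l < K) esym s l * (esymB s r l * esymB s r' l).
Proof.
elim: s r r' K => [|p s IH] r r' [//|K].
  move=> _ _ _; rewrite big_ltn // esym0 mul1r.
  have h : 0 <= \sum_(1 <= i < K.+1) esym [::] i * (esymB [::] r i * esymB [::] r' i).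
    by apply: sumr_ge0 => i _; rewrite !mulr_ge0 ?esymB_ge0 ?esym_ge0.
  rewrite /ovl; case: r => [|r] in h *; last first.
    by rewrite big_nil; apply: addr_ge0 => //; rewrite mulr_ge0 ?esymB_ge0.
  case: r' => [|r'] in h *; last first.
    by rewrite big_seq1 big_nil; apply: addr_ge0 => //; rewrite mulr_ge0 ?esymB_ge0.
  by rewrite !big_seq1 !esymB0 esym0 gcdnn !invr1 !mulr1 lerDl.
have h0 (q q' : nat) : 0 <= \sum_(1 <= i < K.+1)
     esym (p :: s) i * (esymB (p :: s) q i * esymB (p :: s) q' i).
  by apply: sumr_ge0 => i _; rewrite !mulr_ge0 ?esymB_ge0 ?esym_ge0.
move=> /= /andP[ps us] /andP[pp sp] rK.
case: r rK => [|r] rK.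
  rewrite big_ltn // esym0 mul1r /ovl sqf0 big_seq1.
  apply: (@le_trans _ _ (esymB (p :: s) 0 0 * esymB (p :: s) r' 0)); last by rewrite lerDl.
  rewrite !esymB0 esym0 mul1r /esym /mass.
  by apply: ler_sum => m _; rewrite gcd1n invr1 !mul1r.
case: r' => [|r'].
  rewrite big_ltn // esym0 mul1r /ovl.
  apply: (@le_trans _ _ (esymB (p :: s) r.+1 0 * esymB (p :: s) 0 0)); last by rewrite lerDl.
  rewrite !esymB0 esym0 mulr1 /esym /mass.
  by apply: ler_sum => m _; rewrite sqf0 big_seq1 gcdn1 invr1 mul1r mulr1.
rewrite ovl_cons //.
have i1 := IH r.+1 r'.+1 K.+1 us sp rK.
have i2 := IH r r'.+1 K.+1 us sp (ltnW rK).
have i3 := IH r.+1 r' K.+1 us sp rK.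
(* The range is [K], not [K.+1]: this term is matched with the sum shifted by one in [split_sum]. *)
have i4 := IH r r' K us sp rK.
have w0 : 0 <= p%:R^-1 :> R by [].
apply: (le_trans (lerD i1 (ler_wpM2l w0 (lerD (lerD i2 i3) i4)))).
pose X l := esymB (p :: s) r.+1 l * esymB (p :: s) r'.+1 l.
have split_sum : \sum_(0 <= l < K.+1) esym (p :: s) l * X l =
   \sum_(0 <= l < K.+1) esym s l * X l +
   p%:R^-1 * \sum_(0 <= l < K) esym s l * X l.+1.
  rewrite big_nat_recl // [in RHS]big_nat_recl // !esym0 -addrA; congr (_ + _).
  rewrite mulr_sumr -big_split /=; apply: eq_bigr => l _; rewrite esym_cons; ring.
rewrite -/(X _) split_sum !mulrDr !addrA !mulr_sumr -!big_split /=.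
(* The shifted sum dominates the pairs with [p] on both sides; the unshifted one dominates the other
   three terms, with a term in [w^2] to spare. *)
apply: lerD; last first.
  apply: ler_sum => l _; rewrite ler_wpM2l // ler_wpM2l ?esym_ge0 // /X.
  have eS q : esymB s q l <= esymB (p :: s) q.+1 l.+1.
    rewrite esymB_cons /esymB ltnS subSS; case: ifP => lq; last first.
      by rewrite add0r mulr_ge0 //; case: ifP => // _; exact: esym_ge0.
    by rewrite lerDl mulr_ge0 //; case: ifP => // _; exact: esym_ge0.
  by apply: ler_pM; rewrite ?esymB_ge0 ?eS.
apply: ler_sum => l _; rewrite /X !esymB_cons.
have := esym_ge0 s l; have := esymB_ge0 s r l; have := esymB_ge0 s r' l.
move: (p%:R^-1) w0 (esym s l) (esymB s r l) (esymB s r' l) => w w0 e f g g0 f0 e0.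
have : 0 <= e * (w * w * (f * g)) by rewrite !mulr_ge0.
lra.
Qed.

End SquarefreeProducts.

(** * The gcd form of a single block *)

Section Blocks.
Variable R : realType.

Lemma exp_series_le (z : R) (K : nat) : 0 <= z ->
  \sum_(0 <= l < K) z ^+ l / l`!%:R <= expR z.
Proof.
move=> z0.
have -> : \sum_(0 <= l < K) z ^+ l / l`!%:R = series (exp_coeff z) K by [].
rewrite /expR; apply: nondecreasing_cvgn_le; last exact: is_cvg_series_exp_coeff.
by apply: nondecreasing_series => n _ _; exact: exp_coeff_ge0.
Qed.

(** By [esym_le] and [esym_sub_le], the term of index [l] in [ovl_le] is at most [z^l / l!] times
    [esym s r ^ 2], since [z] bounds [mass s * r^2 / M^2]; it remains to sum the exponential
    series. *)
Lemma ovl_le_exp (s : seq nat) (t M z : R) (r : nat) :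
  uniq s -> all prime s -> 0 <= t -> 0 < M -> M <= mass R s - r%:R * t ->
  {in s, forall p, p%:R^-1 <= t} -> mass R s * r%:R ^+ 2 <= z * M ^+ 2 ->
  ovl R s r r <= expR z * esym R s r ^+ 2.
Proof.
move=> us sp t0 M0 MK st mz.
have z0 : 0 <= z.
  rewrite -(@pmulr_lge0 _ (M ^+ 2)) ?exprn_gt0 //.
  by apply: le_trans mz; rewrite mulr_ge0 ?mass_ge0 // exprn_ge0.
apply: le_trans (ovl_le R r us sp (ltnSn r)) _.
apply: (@le_trans _ _ ((\sum_(0 <= l < r.+1) z ^+ l / l`!%:R) * esym R s r ^+ 2)); last first.
  by rewrite ler_wpM2r ?sqr_ge0 // exp_series_le.
rewrite mulr_suml big_nat_cond [leRHS]big_nat_cond.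
apply: ler_sum => l /andP[/andP[_ lr] _].
rewrite /esymB -ltnS lr -expr2.
have h1 := esym_sub_le t0 (ltW M0) MK st (leqnn r) (lr : (l <= r)%N).
have h2 := esym_le R s l.
have Ml0 : 0 < M ^+ l by rewrite exprn_gt0.
have h3 : esym R s (r - l) <= r%:R ^+ l * esym R s r / M ^+ l.
  by rewrite ler_pdivlMr // mulrC.
apply: (@le_trans _ _ ((mass R s ^+ l / l`!%:R) *
    (r%:R ^+ l * esym R s r / M ^+ l) ^+ 2)).
  apply: ler_pM => //; first exact: esym_ge0.
    exact: sqr_ge0.
  by rewrite ler_sqr ?nnegrE ?esym_ge0 // (le_trans (esym_ge0 R s (r - l))).
have -> : mass R s ^+ l / l`!%:R * (r%:R ^+ l * esym R s r / M ^+ l) ^+ 2 =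
   ((mass R s * r%:R ^+ 2) / M ^+ 2) ^+ l / l`!%:R * esym R s r ^+ 2.
  have eX (x : R) : (x ^+ 2) ^+ l = (x ^+ l) ^+ 2 by rewrite -!exprM mulnC.
  rewrite !exprMn !exprVn !eX.
  move: (r%:R ^+ l) (mass R s ^+ l) ((M ^+ l ^+ 2)^-1) (l`!%:R^-1) => u v w v'.
  ring.
apply: ler_wpM2r; first exact: sqr_ge0.
apply: ler_wpM2r => //; apply: lerXn2r; rewrite ?nnegrE //.
  by rewrite mulr_ge0 ?invr_ge0 ?exprn_ge0 ?(ltW M0) // mulr_ge0 ?mass_ge0 // exprn_ge0.
by rewrite ler_pdivrMr ?exprn_gt0.
Qed.

(** The three summands bound the terms [l = 0, 1, 2] of [ovl_le], which account for none, one or two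
    common primes. *)
Lemma ovl2_le (s : seq nat) : uniq s -> all prime s ->
  ovl R s 2 2 <= esym R s 2 ^+ 2 + mass R s ^+ 3 + mass R s ^+ 2 / 2.
Proof.
move=> us sp; apply: le_trans (ovl_le R 2 us sp (ltnSn 2)) _.
rewrite !big_nat_recr //= big_geq // /esymB /= esym0 esym1 /=.
rewrite subn0.
have := esym_le R s 2; rewrite (_ : 2`! = 2)%N //.
lra.
Qed.

Definition blk (s1 : seq nat) (r : nat) (s2 : seq nat) : seq nat :=
  [seq (n * m)%N | n <- sqf s1 r, m <- sqf s2 2].

Lemma mass_blk s1 r s2 : mass R (blk s1 r s2) = esym R s1 r * esym R s2 2.
Proof.
rewrite /mass big_allpairs_dep /= /esym /mass mulr_suml; apply: eq_bigr => n _.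
by rewrite mulr_sumr; apply: eq_bigr => m _; rewrite natrM invfM.
Qed.

Section Disjoint.
Variables (s1 s2 : seq nat) (r : nat).
Hypotheses (p1 : all prime s1) (p2 : all prime s2).
Hypothesis s12 : {in s1, forall p, p \notin s2}.

Lemma coprime_blk k l n m : n \in sqf s1 k -> m \in sqf s2 l -> coprime n m.
Proof.
move=> ns ms; rewrite coprime_sym; apply: coprime_sqf ns => p ps.
rewrite coprime_sym; apply: coprime_prime_sqf ms => //; last exact: s12.
exact: (allP p1).
Qed.

Lemma blk_gt0 : all (ltn 0) (blk s1 r s2).
Proof.
apply/allP => n /allpairsP[[i j] /= [is1 js2 ->]].
by rewrite /= muln_gt0 (sqf_gt0 p1 is1) (sqf_gt0 p2 js2).
Qed.

Lemma blk_uniq : uniq s1 -> uniq s2 -> uniq (blk s1 r s2).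
Proof.
move=> u1 u2; apply: allpairs_uniq; [exact: sqf_uniq | exact: sqf_uniq |].
move=> [n m] [n' m'] /allpairsP[[i j] /= [ni mj [-> ->]]].
move=> /allpairsP[[i' j'] /= [ni' mj' [-> ->]]] /= e.
have c1 := coprime_blk ni mj'; have c2 := coprime_blk ni' mj.
have c3 := coprime_blk ni mj.
have ii : i = i'.
  apply/eqP; rewrite eqn_dvd -(Gauss_dvdl _ c1) -e dvdn_mulr //=.
  by rewrite -(Gauss_dvdl _ c2) e dvdn_mulr.
rewrite -ii in e *; congr (_, _); apply/eqP.
by rewrite -(eqn_pmul2l (sqf_gt0 p1 ni)) e.
Qed.

(** The gcd splits across the coprime small and large parts, so the sum of [gcd / (n m)] factors;
    the square is the contribution of the subtracted 1. *)
Lemma gform_blk : gform R (blk s1 r s2) =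
  ovl R s1 r r * ovl R s2 2 2 - (esym R s1 r * esym R s2 2) ^+ 2.
Proof.
have gcdM n m n' m' : n \in sqf s1 r -> n' \in sqf s1 r -> m \in sqf s2 2 ->
    m' \in sqf s2 2 -> gcdn (n * m) (n' * m') = (gcdn n n' * gcdn m m')%N.
  move=> ns ns' ms ms'.
  have c1 := coprime_blk ns ms'; have c2 := coprime_blk ns' ms.
  have n0 := sqf_gt0 p1 ns; have m0 := sqf_gt0 p2 ms.
  have g0 : (0 < gcdn n n')%N by rewrite gcdn_gt0 n0.
  have d0 : (0 < gcdn m m')%N by rewrite gcdn_gt0 m0.
  have en := divnK (dvdn_gcdl n n'); have en' := divnK (dvdn_gcdr n n').
  have em := divnK (dvdn_gcdl m m'); have em' := divnK (dvdn_gcdr m m').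
  set g := gcdn n n' in g0 en en' *; set d := gcdn m m' in d0 em em' *.
  set n1 := (n %/ g)%N in en; set n1' := (n' %/ g)%N in en'.
  set m1 := (m %/ d)%N in em; set m1' := (m' %/ d)%N in em'.
  (* After division by [g] and [d], each cofactor on one side is coprime to both on the other, so
     the gcd is exactly [g d]. *)
  have cn : coprime n1 n1'.
    by rewrite /coprime -(eqn_pmul2r g0) mul1n muln_gcdl en en'.
  have cm : coprime m1 m1'.
    by rewrite /coprime -(eqn_pmul2r d0) mul1n muln_gcdl em em'.
  have c1' : coprime n1 m1'.
    by apply: coprime_dvdl (coprime_dvdr _ c1); rewrite -?en -?em' dvdn_mulr.
  have c2' : coprime n1' m1.
    by apply: coprime_dvdl (coprime_dvdr _ c2); rewrite -?en' -?em dvdn_mulr.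
  rewrite -en -en' -em -em' !(mulnACA _ g) -muln_gcdl.
  have -> : gcdn (n1 * m1) (n1' * m1') = 1%N.
    by apply/eqP; rewrite -/(coprime _ _) coprimeMl !coprimeMr cn cm c1' coprime_sym c2'.
  by rewrite mul1n.
rewrite -mass_blk.
have -> : gform R (blk s1 r s2) = \sum_(n <- blk s1 r s2) \sum_(m <- blk s1 r s2)
    (gcdn n m)%:R * (n%:R^-1 * m%:R^-1) -
    \sum_(n <- blk s1 r s2) n%:R^-1 * mass R (blk s1 r s2).
  rewrite -sumrB /gform; apply: eq_bigr => n _.
  by rewrite /mass mulr_sumr -sumrB; apply: eq_bigr => m _; ring.
congr (_ - _); last by rewrite -mulr_suml expr2.
rewrite big_allpairs_dep /= /ovl mulr_suml.
rewrite big_seq [RHS]big_seq; apply: eq_bigr => n ns.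
under eq_bigr do rewrite big_allpairs_dep /=.
rewrite exchange_big /= mulr_suml big_seq [RHS]big_seq; apply: eq_bigr => n' ns'.
rewrite mulr_sumr big_seq [RHS]big_seq; apply: eq_bigr => m ms.
rewrite mulr_sumr big_seq [RHS]big_seq; apply: eq_bigr => m' ms'.
by rewrite gcdM // !natrM !invfM; ring.
Qed.

Lemma gform_blk_le (z : R) : 0 <= z -> uniq s2 ->
  ovl R s1 r r <= expR z * esym R s1 r ^+ 2 ->
  gform R (blk s1 r s2) <= esym R s1 r ^+ 2 *
    ((expR z - 1) * esym R s2 2 ^+ 2 +
     expR z * (mass R s2 ^+ 3 + mass R s2 ^+ 2 / 2)).
Proof.
move=> z0 u2 h1; rewrite gform_blk.
have h2 := ovl2_le u2 p2.
have o2 : 0 <= ovl R s2 2 2.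
  by apply: sumr_ge0 => n _; apply: sumr_ge0 => m _; rewrite !mulr_ge0.
have := ler_wpM2r o2 h1.
have e0 : 0 <= expR z * esym R s1 r ^+ 2 by rewrite mulr_ge0 ?expR_ge0 ?sqr_ge0.
have := ler_wpM2l e0 h2; rewrite exprMn.
lra.
Qed.

End Disjoint.

Definition prange (y z : R) : seq nat :=
  [seq p <- primes_upto (Num.truncn z) | y < p%:R].

Lemma mem_prange y z p : 0 <= z -> (p \in prange y z) = [&& prime p, y < p%:R & p%:R <= z].
Proof.
move=> z0; rewrite !mem_filter mem_index_iota /= ltnS truncn_ge_nat //.
by rewrite andbCA.
Qed.

Lemma prange_uniq y z : uniq (prange y z).
Proof. by rewrite filter_uniq // primes_upto_uniq. Qed.

Lemma prange_prime y z : all prime (prange y z).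
Proof. by apply/allP => p; rewrite !mem_filter => /and3P[]. Qed.

Lemma mass_prange y z : 0 <= y -> y <= z ->
  mass R (prange y z) = recp R (Num.truncn z) - recp R (Num.truncn y).
Proof.
move=> y0 yz; have z0 : 0 <= z by lra.
have ly : (Num.truncn y <= Num.truncn z)%N by exact: le_truncn.
rewrite /mass /prange /primes_upto big_filter big_filter_cond /recp.
have -> : \sum_(0 <= p < (Num.truncn z).+1 | prime p) p%:R^-1 =
    \sum_(0 <= p < (Num.truncn y).+1 | prime p) p%:R^-1 +
    \sum_((Num.truncn y).+1 <= p < (Num.truncn z).+1 | prime p) p%:R^-1 :> R.
  by rewrite (@big_cat_nat _ _ _ (Num.truncn y).+1).
rewrite [RHS]addrAC subrr add0r (@big_cat_nat _ _ _ (Num.truncn y).+1) //=.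
rewrite [X in X + _]big_nat_cond [X in X + _]big_pred0 ?add0r; last first.
  move=> p; apply/negbTE; rewrite negb_and -implybE; apply/implyP.
  rewrite /= ltnS truncn_ge_nat // => py.
  by rewrite negb_and ltNge py orbT.
rewrite big_nat_cond [RHS]big_nat_cond; apply: eq_bigl => p.
have [/andP[yp pz]|] /= := boolP (_ < p < _)%N => //.
rewrite (_ : y < p%:R) ?andbT //.
by rewrite ltNge -truncn_ge_nat // -ltnNge.
Qed.

End Blocks.

(** * Sizes of the symmetric sums over the small and the large primes *)

Section BlockEstimates.
Variable R : realType.
Implicit Types (a c x y z : R) (k : nat).

Definition mertens_const c :=
  1 <= c /\ forall y, 2 <= y -> `|recp R (Num.truncn y) - ln (ln y)| <= c.

Lemma mass_prange_bound c y z : mertens_const c -> 2 <= y -> y <= z ->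
  `|mass R (prange y z) - (ln (ln z) - ln (ln y))| <= 2 * c.
Proof.
move=> [_ Hc] y2 yz; rewrite mass_prange //; last by lra.
have := Hc y y2; have := Hc z (le_trans y2 yz).
rewrite !ler_norml => /andP[? ?] /andP[? ?]; apply/andP; split; lra.
Qed.

Lemma bernoulli_ge (u : R) (n : nat) : 0 <= u <= 1 -> 1 - n%:R * u <= (1 - u) ^+ n.
Proof.
move=> /andP[u0 u1]; elim: n => [|n IH]; first by rewrite mul0r subr0 expr0.
have v0 : 0 <= 1 - u by lra.
rewrite exprS; apply: le_trans (ler_wpM2l v0 IH).
have : 0 <= n%:R * (u * u) by rewrite !mulr_ge0.
rewrite -natr1; lra.
Qed.

(* With [a = C0^-2]: [towx a k = x_k], [towy a k = x_k^(1/2k)], [quarter x = x^(1/4)], and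
   [gk a k] is the factor [k^(2k) C0^(-2k) / k!] of [F]; in the next section [hx] is [h] and
   [Hk a k = h(x_(k+1))]. *)
Definition towx a k : R := expR (expR (a * k%:R ^+ 2)).
Definition towy a k : R := expR (expR (a * k%:R ^+ 2) / (2 * k%:R)).
Definition quarter x : R := expR (ln x / 4).
Definition gk a k : R := (a * k%:R ^+ 2) ^+ k / k`!%:R.

Definition small_primes a (T : R) k := prange T (towy a k).
Definition large_primes a k := prange (towx a k) (quarter (towx a k.+1)).

Lemma small_primes_sum a c : 0 < a -> mertens_const c ->
  exists2 T : R, 2 <= T &
  \forall k \near \oo, [/\ T <= towy a k,
    mass R (small_primes a T k) <= a * k%:R ^+ 2 &
    a * k%:R ^+ 2 - a * k%:R / 2 <= mass R (small_primes a T k) - k%:R * T^-1].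
Proof.
move=> a0 Mc; have [c1 Hc] := Mc.
(* The first summand gives [ln (ln T) >= 2 c], which swallows the Mertens error in the upper bound;
   the second keeps the loss [k / T] below [a k / 8]. *)
pose T := expR (expR (2 * c)) + 8 / a.
have ee : 2 <= expR (expR (2 * c)).
  have := @expR_ge1Dx R (expR (2 * c)); have := @expR_ge1Dx R (2 * c); lra.
have a8 : 0 < 8 / a by rewrite divr_gt0.
have T2 : 2 <= T by rewrite /T; lra.
have T0 : 0 < T by lra.
exists T => //.
have llT : 2 * c <= ln (ln T).
  have h1 : expR (2 * c) <= ln T.
    by rewrite -[leLHS]expRK ler_ln ?posrE ?expR_gt0 // /T; lra.
  by rewrite -[leLHS]expRK ler_ln ?posrE ?expR_gt0 // (lt_le_trans _ h1) ?expR_gt0.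
have TV : T^-1 <= a / 8.
  rewrite -[leRHS]invrK lef_pV2 ?posrE ?invr_gt0 ?divr_gt0 //.
  by rewrite invf_div /T; lra.
near=> k.
have k1 : 1 <= k%:R :> R by near: k; exact: nbhs_infty_ger.
have k0 : 0 < k%:R :> R by lra.
have kbig : 4 / a * (- 1 - ln (a / 16) + ln (ln T) + 2 * c) <= k%:R.
  by near: k; exact: nbhs_infty_ger.
have {}kbig : - 1 - ln (a / 16) + ln (ln T) + 2 * c <= a * k%:R / 4.
  have a4 : 0 <= a / 4 by rewrite divr_ge0 // ltW.
  have := ler_wpM2l a4 kbig.
  have -> : a / 4 * (4 / a * (- 1 - ln (a / 16) + ln (ln T) + 2 * c)) =
    - 1 - ln (a / 16) + ln (ln T) + 2 * c by field; rewrite gt_eqF.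
  lra.
(* [ln (2 k)] comes from the exponent [1/(2k)] in [towy]; the tangent inequality, applied to
   [a / 16] times [2 k], bounds it by [a k / 8] plus a constant. *)
have l2k : ln (2 * k%:R) <= a * k%:R / 8 - 1 - ln (a / 16).
  have a16 : 0 < a / 16 by rewrite divr_gt0.
  have u0 : 0 < a / 16 * (2 * k%:R) by rewrite !mulr_gt0.
  have := ln_le_subr1 u0; rewrite lnM ?posrE ?mulr_gt0 //; lra.
have l2k0 : 0 <= ln (2 * k%:R : R) by rewrite ln_ge0 //; lra.
have kT : k%:R * T^-1 <= a * k%:R / 8.
  by have := ler_wpM2l (ltW k0) TV; lra.
have ak0 : 0 < a * k%:R by rewrite mulr_gt0.
have ak2 : a * k%:R <= a * k%:R ^+ 2.
  by rewrite expr2 mulrA ler_peMr // ltW.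
have llY : ln (ln (towy a k)) = a * k%:R ^+ 2 - ln (2 * k%:R).
  rewrite /towy expRK ln_div ?posrE ?expR_gt0 ?mulr_gt0 // expRK //.
have lnT : 0 < ln T by rewrite ln_gt0 //; lra.
have TY : T <= towy a k.
  rewrite -(ler_ln (_ : T \in Num.pos)) ?posrE ?expR_gt0 //.
  rewrite -ler_ln ?posrE //; first by rewrite llY; lra.
  by rewrite /towy expRK divr_gt0 ?expR_gt0 // mulr_gt0.
have := mass_prange_bound Mc T2 TY; rewrite llY ler_norml => /andP[b1 b2].
split=> //; rewrite /small_primes; lra.
Unshelve. all: by end_near. Qed.

(** Put [k = r + 1]. The main term is [(a k^2)^(k-1) / (k-1)! = gk / (a k)]. Using
    [M = a k (k - 1/2)] instead of [a k^2] loses at most half of it, by Bernoulli; and as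
    [r = k - 1 <= k - 1/2], the ratio [mass r^2 / M^2] is at most [1 / a], the exponent in the
    overlap bound. *)
Lemma small_primes_esym_step a (T : R) r : 0 < a -> 2 <= T -> (0 < r)%N ->
  mass R (small_primes a T r.+1) <= a * r.+1%:R ^+ 2 ->
  a * r.+1%:R ^+ 2 - a * r.+1%:R / 2 <= mass R (small_primes a T r.+1) - r.+1%:R * T^-1 ->
  [/\ gk a r.+1 / (2 * a * r.+1%:R) <= esym R (small_primes a T r.+1) r,
      esym R (small_primes a T r.+1) r <= gk a r.+1 / (a * r.+1%:R) &
      ovl R (small_primes a T r.+1) r r <=
        expR a^-1 * esym R (small_primes a T r.+1) r ^+ 2].
Proof.
move=> a0 T2 r0 m_le m_ge.
set s := small_primes a T r.+1 in m_le m_ge *.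
have T0 : 0 < T by lra.
have t0 : 0 <= T^-1 by rewrite invr_ge0 ltW.
have st : {in s, forall p, p%:R^-1 <= T^-1 :> R}.
  move=> p; rewrite mem_prange; last by rewrite ltW // expR_gt0.
  case/and3P => _ Tp _; rewrite lef_pV2 ?posrE //; [exact: ltW | lra].
set k : R := r.+1%:R in m_le m_ge *.
have k1 : 2 <= k by rewrite ler_nat.
pose M := a * k ^+ 2 - a * k / 2.
have ak0 : 0 < a * k by rewrite mulr_gt0 //; lra.
have M0 : 0 < M.
  have -> : M = a * k * (k - 1 / 2) by rewrite /M; field.
  by rewrite mulr_gt0 //; lra.
have ak20 : 0 < a * k ^+ 2 by rewrite mulr_gt0 // exprn_gt0 //; lra.
have gE : gk a r.+1 / (a * k) = (a * k ^+ 2) ^+ r / r`!%:R.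
  rewrite /gk -/k factS natrM -/k exprS; field.
  by rewrite !gt_eqF ?ltr0n ?fact_gt0 //; lra.
split.
- apply: le_trans (esym_ge t0 (ltW M0) m_ge st (leqnSn r)).
  rewrite -/M -[2 * a * _]mulrA invfM mulrCA gE mulrA ler_wpM2r //.
  have -> : M = a * k ^+ 2 * (1 - 1 / (2 * k)).
    by rewrite /M; field; rewrite gt_eqF //; lra.
  rewrite [leRHS]exprMn [leLHS]mulrC ler_pM2l ?exprn_gt0 //.
  apply: le_trans (bernoulli_ge _ _); last first.
    rewrite divr_ge0 //=; last by lra.
    by rewrite ler_pdivrMr; lra.
  have -> : r%:R = k - 1 :> R by rewrite /k -natr1 addrK.
  rewrite -subr_ge0; have -> : 1 - (k - 1) * (1 / (2 * k)) - 2^-1 = 1 / (2 * k).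
    by field; rewrite gt_eqF //; lra.
  by rewrite divr_ge0 //; lra.
- apply: le_trans (esym_le R s r) _; rewrite gE ler_wpM2r //.
  by apply: lerXn2r => //; rewrite nnegrE ?mass_ge0 // ltW.
apply: (@ovl_le_exp _ _ T^-1 M) => //; [exact: prange_uniq | exact: prange_prime | |].
  apply: le_trans m_ge _; rewrite lerD2l lerN2; apply: ler_wpM2r => //.
  by rewrite /k ler_nat.
have -> : r%:R = k - 1 :> R by rewrite /k -natr1 addrK.
have kk : (k - 1) ^+ 2 <= (k - 1 / 2) ^+ 2 by rewrite ler_sqr ?nnegrE; lra.
apply: (@le_trans _ _ (a * k ^+ 2 * (k - 1 / 2) ^+ 2)).
  by apply: ler_pM; rewrite ?mass_ge0 ?sqr_ge0.
rewrite le_eqVlt; apply/orP; left; apply/eqP.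
by rewrite /M; field; rewrite gt_eqF.
Qed.

Lemma small_primes_esym a c : 0 < a -> mertens_const c ->
  exists2 T : R, 2 <= T &
  \forall k \near \oo,
    [/\ gk a k / (2 * a * k%:R) <= esym R (small_primes a T k) k.-1,
        esym R (small_primes a T k) k.-1 <= gk a k / (a * k%:R) &
        ovl R (small_primes a T k) k.-1 k.-1 <=
          expR a^-1 * esym R (small_primes a T k) k.-1 ^+ 2].
Proof.
move=> a0 Mc; have [T T2 near_k] := small_primes_sum a0 Mc.
exists T => //; near=> k.
have k2 : (1 < k)%N by near: k; exact: nbhs_infty_gt.
have [_ m_le m_ge] : [/\ T <= towy a k,
    mass R (small_primes a T k) <= a * k%:R ^+ 2 &
    a * k%:R ^+ 2 - a * k%:R / 2 <= mass R (small_primes a T k) - k%:R * T^-1].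
  by near: k.
have kE : k = k.-1.+1 by rewrite prednK //; lia.
rewrite kE /=; apply: small_primes_esym_step => //; rewrite -?kE //; lia.
Unshelve. all: by end_near. Qed.

Lemma ln_towx a k : ln (ln (towx a k)) = a * k%:R ^+ 2.
Proof. by rewrite /towx !expRK. Qed.

Lemma towx_gt1 a k : 1 < towx a k.
Proof. by rewrite /towx expR_gt1 expR_gt0. Qed.

(** Mertens gives the difference of [ln ln] with an additive error [2 c]; the added 1, the same as
    in [h], turns this into a multiplicative constant. *)
Lemma large_primes_upper a c k x : mertens_const c -> 2 <= towx a k ->
  towx a k <= x ->
  mass R [seq p <- large_primes a k | p%:R <= x]
    <= 2 * c * (ln (ln x) - a * k%:R ^+ 2 + 1).
Proof.
move=> Mc X2 Xx; have [c1 _] := Mc.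
apply: (@le_trans _ _ (mass R (prange (towx a k) x))).
  apply: sum_seq_subset => //; first by rewrite filter_uniq // prange_uniq.
  have x0 : 0 <= x by lra.
  move=> p; rewrite mem_filter /large_primes !mem_prange ?expR_ge0 //.
  by move=> /andP[-> /and3P[-> -> _]].
have := mass_prange_bound Mc X2 Xx; rewrite ln_towx ler_norml => /andP[_ b].
have lnX : 0 < ln (towx a k) by rewrite ln_gt0 // towx_gt1.
have lX : ln (towx a k) <= ln x by rewrite ler_ln ?posrE //; lra.
have : a * k%:R ^+ 2 <= ln (ln x) by rewrite -ln_towx ler_ln ?posrE //; lra.
move=> hl; have : 0 <= (2 * c - 1) * (ln (ln x) - a * k%:R ^+ 2) by rewrite mulr_ge0 //; lra.
lra.
Qed.

Lemma large_primes_lower a c k x : mertens_const c -> 2 <= towx a k ->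
  towx a k <= x -> x <= towx a k.+1 ->
  ln (ln x) - a * k%:R ^+ 2 - ln 4 - 2 * c
    <= mass R [seq p <- large_primes a k | p%:R <= quarter x].
Proof.
move=> Mc X2 Xx xX; have [c1 _] := Mc.
have lnX : 0 < ln (towx a k) by rewrite ln_gt0 // towx_gt1.
have lX : ln (towx a k) <= ln x by rewrite ler_ln ?posrE //; lra.
have lx0 : 0 < ln x by lra.
have llq : ln (ln (quarter x)) = ln (ln x) - ln 4.
  by rewrite /quarter expRK ln_div ?posrE.
(* If [x^(1/4)] lies below [x_k] there are no primes to count, but then the left-hand side is
   negative. *)
have [Xq|qX] := leP (towx a k) (quarter x); last first.
  apply: (@le_trans _ _ 0); last exact: mass_ge0.
  have : ln (ln (quarter x)) <= a * k%:R ^+ 2.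
    rewrite -ln_towx ler_ln ?posrE //; last by rewrite /quarter expRK divr_gt0.
    by rewrite ler_ln ?posrE ?expR_gt0 // ltW.
  by rewrite llq; lra.
have := mass_prange_bound Mc X2 Xq; rewrite ln_towx llq ler_norml => /andP[b _].
apply: (@le_trans _ _ (mass R (prange (towx a k) (quarter x)))); first by lra.
apply: sum_seq_subset => //; first exact: prange_uniq.
move=> p; rewrite mem_prange ?expR_ge0 // => /and3P[pp Xp pq].
rewrite mem_filter /large_primes mem_prange ?expR_ge0 // pp Xp pq /=; apply: le_trans pq _.
have xpos : 0 < x by lra.
have lxX : ln x <= ln (towx a k.+1) by rewrite ler_ln ?posrE ?expR_gt0.
by rewrite /quarter ler_expR ler_pM2r.
Qed.

(** The numerical core of [block_gform_le]: [e] and [e2] stand for the symmetric sums of the small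
    and large primes, [m] for the mass of the large ones. Pairs sharing a large prime lack the
    factor [E - 1] but are of order [hh^3] instead of [hh^4]; the last hypothesis absorbs them. The
    constant is [224 = 64 + 160]. *)
Lemma gform_bound_num (e e2 m c hh H g E : R) :
  0 <= e -> e <= 4 * g / H -> 0 <= m -> m <= 2 * c * hh ->
  0 <= e2 -> e2 <= m ^+ 2 / 2 -> 1 <= c -> 1 <= hh -> 0 < H -> 1 < E ->
  hh / H <= (E - 1) / E * (1 + hh ^+ 2 / H) ->
  e ^+ 2 * ((E - 1) * e2 ^+ 2 + E * (m ^+ 3 + m ^+ 2 / 2)) <=
  224 * c ^+ 4 * (E - 1) * (g * (1 + hh ^+ 2 / H)) ^+ 2.
Proof.
move=> e0 eg m0 mh e20 e2m c1 h1 H0 E1 hH.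
set u := hh ^+ 2 / H in hH *.
have u0 : 0 <= u by rewrite divr_ge0 ?sqr_ge0 ?ltW.
have ch0 : 0 <= 2 * c * hh by lra.
have m2 : m ^+ 2 <= (2 * c * hh) ^+ 2 by rewrite ler_sqr ?nnegrE.
have m3 : m ^+ 3 <= (2 * c * hh) ^+ 3 by apply: lerXn2r.
have e2h : e2 <= 2 * c ^+ 2 * hh ^+ 2 by lra.
have e2s : e2 ^+ 2 <= 4 * c ^+ 4 * hh ^+ 4.
  have -> : 4 * c ^+ 4 * hh ^+ 4 = (2 * c ^+ 2 * hh ^+ 2) ^+ 2 by ring.
  by rewrite ler_sqr ?nnegrE //; apply: le_trans e2h.
have mm : m ^+ 3 + m ^+ 2 / 2 <= 10 * c ^+ 4 * hh ^+ 3.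
  have c34 : c ^+ 3 <= c ^+ 4 by rewrite ler_weXn2l.
  have c24 : c ^+ 2 <= c ^+ 4 by rewrite ler_weXn2l.
  have h23 : hh ^+ 2 <= hh ^+ 3 by rewrite ler_weXn2l.
  have h30 : 0 <= hh ^+ 3 by rewrite exprn_ge0 //; lra.
  have c20 : 0 <= c ^+ 2 by exact: sqr_ge0.
  have := ler_wpM2r h30 c34.
  have := ler_pM c20 (sqr_ge0 hh) c24 h23.
  move: m2 m3; rewrite !exprMn; lra.
have e_sq : e ^+ 2 <= (4 * g / H) ^+ 2 by rewrite ler_sqr ?nnegrE //; apply: le_trans eg.
apply: (@le_trans _ _ ((4 * g / H) ^+ 2 *
    ((E - 1) * (4 * c ^+ 4 * hh ^+ 4) + E * (10 * c ^+ 4 * hh ^+ 3)))).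
  apply: ler_pM => //; first exact: sqr_ge0.
    apply: addr_ge0; first by rewrite mulr_ge0 ?sqr_ge0 //; lra.
    by rewrite mulr_ge0 ?addr_ge0 ?divr_ge0 ?exprn_ge0 //; lra.
  by apply: lerD; apply: ler_wpM2l => //; lra.
have -> : (4 * g / H) ^+ 2 *
    ((E - 1) * (4 * c ^+ 4 * hh ^+ 4) + E * (10 * c ^+ 4 * hh ^+ 3)) =
   64 * c ^+ 4 * g ^+ 2 * ((E - 1) * u ^+ 2) + 160 * c ^+ 4 * g ^+ 2 * (E * u * (hh / H)).
  by rewrite /u; field; rewrite gt_eqF.
have k1 : E * u * (hh / H) <= (E - 1) * (1 + u) ^+ 2.
  apply: (@le_trans _ _ (E * u * ((E - 1) / E * (1 + u)))).
    by apply: ler_wpM2l => //; rewrite mulr_ge0 //; lra.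
  have -> : E * u * ((E - 1) / E * (1 + u)) = (E - 1) * (u * (1 + u)).
    by field; apply/eqP; lra.
  apply: ler_wpM2l; first by lra.
  by rewrite expr2; apply: ler_wpM2r; lra.
have k2 : (E - 1) * u ^+ 2 <= (E - 1) * (1 + u) ^+ 2.
  by apply: ler_wpM2l; [lra | rewrite ler_sqr ?nnegrE; lra].
have cg : 0 <= c ^+ 4 * g ^+ 2 by rewrite mulr_ge0 ?sqr_ge0 // exprn_ge0 //; lra.
have := ler_wpM2l cg k1; have := ler_wpM2l cg k2.
rewrite [(g * _) ^+ 2]exprMn.
move: (c ^+ 4) (g ^+ 2) ((1 + u) ^+ 2) => c4 g2 v.
lra.
Qed.

End BlockEstimates.

(** * Growth of [gk], and the properties of a block of large index *)

Section Construction.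
Variable R : realType.
Implicit Types (a c x T E : R) (k : nat).

Definition hx a k x : R := ln (ln x) - a * k%:R ^+ 2 + 1.
Definition Hk a k : R := a * (2 * k%:R + 1) + 1.
Definition block a T k x : seq nat :=
  blk (small_primes a T k) k.-1 [seq p <- large_primes a k | p%:R <= x].

Lemma gk_ge0 a k : 0 <= a -> 0 <= gk a k.
Proof.
by move=> a0; rewrite divr_ge0 // exprn_ge0 // mulr_ge0 // exprn_ge0.
Qed.

Lemma gk_gt0 a k : 0 < a -> (0 < k)%N -> 0 < gk a k.
Proof.
move=> a0 k0; rewrite divr_gt0 ?ltr0n ?fact_gt0 // exprn_gt0 //.
by rewrite mulr_gt0 // exprn_gt0 // ltr0n.
Qed.

(** The factor [(1 + 1/k)^(2k)] lies between 1 and [exp 2], so consecutive values have ratio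
    [a (k + 1)] up to a constant, the same order as [Hk]. *)
Lemma gkS a k : (0 < k)%N ->
  gk a k.+1 = gk a k * (a * k.+1%:R) * ((1 + k%:R^-1) ^+ k) ^+ 2.
Proof.
move=> k0; have kn0 : k%:R != 0 :> R by rewrite pnatr_eq0 -lt0n.
have k1n0 : k.+1%:R != 0 :> R by rewrite pnatr_eq0.
have fn0 : k`!%:R != 0 :> R by rewrite pnatr_eq0 -lt0n fact_gt0.
have kE : k.+1%:R = k%:R * (1 + k%:R^-1) :> R by rewrite -natr1 mulrDr mulr1 divff.
have -> : gk a k.+1 = (a * k.+1%:R ^+ 2) ^+ k * (a * k.+1%:R) / k`!%:R.
  by rewrite /gk exprS factS natrM; move: (X in X ^+ k) => w; move: k1n0; rewrite -natr1 => k1n0; field; rewrite fn0 k1n0.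
have eX (x : R) : (x ^+ 2) ^+ k = (x ^+ k) ^+ 2 by rewrite -!exprM mulnC.
have eP : (a * k.+1%:R ^+ 2) ^+ k =
    (a * k%:R ^+ 2) ^+ k * ((1 + k%:R^-1) ^+ k) ^+ 2.
  by rewrite kE -eX -exprMn; congr (_ ^+ k); ring.
rewrite eP /gk; ring.
Qed.

Lemma gkS_ge a k : 0 < a -> (0 < k)%N -> gk a k * (a * k.+1%:R) <= gk a k.+1.
Proof.
move=> a0 k0; rewrite gkS // ler_peMr //.
  by rewrite mulr_ge0 ?gk_ge0 ?(ltW a0) // mulr_ge0 // ltW.
by rewrite exprn_ege1 // exprn_ege1 // lerDl.
Qed.

Lemma gkS_le a k : 0 < a -> (0 < k)%N ->
  gk a k.+1 <= gk a k * (a * k.+1%:R) * expR 2.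
Proof.
move=> a0 k0; rewrite gkS //; apply: ler_wpM2l.
  by rewrite mulr_ge0 ?gk_ge0 ?(ltW a0) // mulr_ge0 // ltW.
have kn0 : k%:R != 0 :> R by rewrite pnatr_eq0 -lt0n.
have -> : expR 2 = ((expR k%:R^-1) ^+ k) ^+ 2 :> R.
  by rewrite -!expRM_natl divff // mulr1.
have b0 : 0 <= 1 + k%:R^-1 :> R by rewrite addr_ge0.
apply: lerXn2r; rewrite ?nnegrE ?exprn_ge0 ?expR_ge0 //.
apply: lerXn2r; rewrite ?nnegrE ?expR_ge0 //.
exact: expR_ge1Dx.
Qed.

Lemma hx_towx a k : hx a k (towx a k.+1) = Hk a k.
Proof. by rewrite /hx ln_towx /Hk -natr1; ring. Qed.

Lemma towx_le a k x : 1 < x -> (towx a k <= x) = (a * k%:R ^+ 2 <= ln (ln x)).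
Proof.
move=> x1; have l0 : 0 < ln x by rewrite ln_gt0.
rewrite -ln_towx ler_ln ?posrE ?ln_gt0 ?towx_gt1 // ler_ln ?posrE ?expR_gt0 //.
by apply: lt_trans x1.
Qed.

Lemma towx_mono a j k : 0 <= a -> (j <= k)%N -> towx a j <= towx a k.
Proof.
move=> a0 jk; rewrite /towx !ler_expR ler_wpM2l //.
by rewrite ler_sqr ?nnegrE // ler_nat.
Qed.

(** What the estimates require of a large [k]. [good_E] absorbs the pairs sharing a large prime,
    [good_K] gives [h^2 <= Hk] when [1 <= h < K], and [good_ratio] makes [gk] at least double. *)
Record good_index a T E (K : R) k : Prop := GoodIndex {
  good_pos : (1 < k)%N;
  good_esym_ge : gk a k / (2 * a * k%:R) <= esym R (small_primes a T k) k.-1;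
  good_esym_le : esym R (small_primes a T k) k.-1 <= gk a k / (a * k%:R);
  good_ovl : ovl R (small_primes a T k) k.-1 k.-1 <=
    E * esym R (small_primes a T k) k.-1 ^+ 2;
  good_towx : 2 <= towx a k;
  good_H : Hk a k <= 4 * a * k%:R;
  good_E : forall h : R, 1 <= h -> h / Hk a k <= (E - 1) / E * (1 + h ^+ 2 / Hk a k);
  good_K : K ^+ 2 <= Hk a k;
  good_ratio : 2 <= a * k.+1%:R }.

Lemma good_index_near a c K : 0 < a -> mertens_const c ->
  exists2 T : R, 2 <= T & \forall k \near \oo, good_index a T (expR a^-1) K k.
Proof.
move=> a0 Mc; have [T T2 near_k] := small_primes_esym a0 Mc.
exists T => //.
have E1 : 1 < expR a^-1 by rewrite expR_gt1 invr_gt0.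
set E := expR a^-1 in E1 near_k *.
pose e := (E - 1) / E; have e0 : 0 < e by rewrite divr_gt0; lra.
have a20 : 0 < 2 * a by lra.
near=> k.
have [i1 i2 i3] : [/\ gk a k / (2 * a * k%:R) <= esym R (small_primes a T k) k.-1,
        esym R (small_primes a T k) k.-1 <= gk a k / (a * k%:R) &
        ovl R (small_primes a T k) k.-1 k.-1 <=
          E * esym R (small_primes a T k) k.-1 ^+ 2] by near: k.
have bigE (D : R) : D / (2 * a) <= k%:R -> D <= 2 * a * k%:R.
  by rewrite ler_pdivrMr // mulrC.
have b1 : (4 * e ^+ 2)^-1 <= 2 * a * k%:R by apply: bigE; near: k; exact: nbhs_infty_ger.
have b2 : K ^+ 2 <= 2 * a * k%:R by apply: bigE; near: k; exact: nbhs_infty_ger.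
have b3 : a + 1 <= 2 * a * k%:R by apply: bigE; near: k; exact: nbhs_infty_ger.
have b4 : 4 <= 2 * a * k%:R by apply: bigE; near: k; exact: nbhs_infty_ger.
have HE : 2 * a * k%:R <= Hk a k by rewrite /Hk; lra.
have H0 : 0 < Hk a k by lra.
split=> //.
- by near: k; exact: nbhs_infty_gt.
- have : 1 <= k%:R :> R by near: k; exact: nbhs_infty_ger.
  move=> k1; have := @expR_ge1Dx R (a * k%:R ^+ 2).
  have := @expR_ge1Dx R (expR (a * k%:R ^+ 2)).
  have : 0 <= a * k%:R ^+ 2 by rewrite mulr_ge0 ?sqr_ge0 // ltW.
  rewrite /towx; lra.
- by rewrite /Hk; lra.
- move=> h h1; rewrite -/e.
  (* Completing the square; the constant [1 / (4 e)] is then at most [e Hk] because [k] is large. *)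
  have s1 : h <= e * h ^+ 2 + (4 * e)^-1.
    rewrite -subr_ge0; have -> : e * h ^+ 2 + (4 * e)^-1 - h = (2 * e * h - 1) ^+ 2 / (4 * e).
      by field; rewrite gt_eqF.
    by rewrite divr_ge0 ?sqr_ge0 //; lra.
  have s2 : (4 * e)^-1 <= e * Hk a k.
    apply: (@le_trans _ _ (e * (4 * e ^+ 2)^-1)).
      rewrite le_eqVlt; apply/orP; left; apply/eqP; field; by rewrite gt_eqF.
    by apply: ler_wpM2l; [exact: ltW | apply: le_trans HE].
  rewrite ler_pdivrMr // -mulrA mulrDl mul1r divfK ?gt_eqF // mulrDr; lra.
- exact: le_trans HE.
by rewrite -natr1; lra.
Unshelve. all: by end_near. Qed.

Section GoodBlock.
Variables (a c T E K : R) (k : nat).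
Hypotheses (a0 : 0 < a) (Mc : mertens_const c) (E1 : 1 < E).
Hypothesis good : good_index a T E K k.

Lemma good_k_gt0 : 0 < k%:R :> R.
Proof. by rewrite ltr0n (ltn_trans _ (good_pos good)). Qed.

Lemma small_large_disjoint (P : pred nat) :
  {in small_primes a T k, forall p, p \notin [seq p <- large_primes a k | P p]}.
Proof.
move=> p; rewrite mem_prange ?expR_ge0 // => /and3P[_ _ py].
rewrite mem_filter /large_primes mem_prange ?expR_ge0 // !negb_and -leNgt.
apply/or4P; constructor 3; apply: le_trans py _.
have k1 : 1 <= k%:R :> R by rewrite ler1n (ltn_trans _ (good_pos good)).
rewrite /towy /towx ler_expR ler_pdivrMr; last by lra.
by rewrite ler_peMr ?expR_ge0 //; lra.
Qed.

Let ep x := [seq p <- large_primes a k | p%:R <= x].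

Lemma large_filter_prime (P : pred nat) : all prime [seq p <- large_primes a k | P p].
Proof.
apply/allP => p; rewrite mem_filter => /andP[_]; exact: (allP (prange_prime _ _)).
Qed.

Lemma block_gt0 x : all (ltn 0) (block a T k x).
Proof. by apply: blk_gt0; [exact: prange_prime | exact: large_filter_prime]. Qed.

Lemma Hk_gt0 : 0 < Hk a k.
Proof. by rewrite /Hk; apply: addr_gt0 => //; rewrite mulr_gt0 // ltr_wpDl. Qed.

Lemma esym_le_H : esym R (small_primes a T k) k.-1 <= 4 * gk a k / Hk a k.
Proof.
apply: le_trans (good_esym_le good) _.
have k0 := good_k_gt0.
rewrite ler_pdivlMr ?Hk_gt0 // mulrAC ler_pdivrMr ?mulr_gt0 //.
have := ler_wpM2l (gk_ge0 k (ltW a0)) (good_H good); lra.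
Qed.

Lemma hx_ge1 x : towx a k <= x -> 1 <= hx a k x.
Proof.
move=> kx; have x1 : 1 < x by apply: lt_le_trans (towx_gt1 a k) kx.
by move: kx; rewrite towx_le // /hx; lra.
Qed.

Lemma block_mass_le x : towx a k <= x ->
  mass R (block a T k x) <= 8 * c ^+ 2 * (gk a k * (1 + hx a k x ^+ 2 / Hk a k)).
Proof.
move=> kx; rewrite mass_blk.
have mh := large_primes_upper Mc (good_towx good) kx.
rewrite -/(hx a k x) -/(ep x) in mh *.
have h1 := hx_ge1 kx; have [c1 _] := Mc.
have m0 := mass_ge0 R (ep x).
have e2 : esym R (ep x) 2 <= 2 * c ^+ 2 * hx a k x ^+ 2.
  have := esym_le R (ep x) 2; rewrite (_ : 2`! = 2)%N // => /le_trans; apply.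
  have : mass R (ep x) ^+ 2 <= (2 * c * hx a k x) ^+ 2.
    by rewrite ler_sqr ?nnegrE //; apply: le_trans mh.
  rewrite !exprMn; lra.
apply: (le_trans (ler_pM (esym_ge0 _ _ _) (esym_ge0 _ _ _) esym_le_H e2)).
have g0 := gk_ge0 k (ltW a0).
have -> : 4 * gk a k / Hk a k * (2 * c ^+ 2 * hx a k x ^+ 2) =
  8 * c ^+ 2 * (gk a k * (hx a k x ^+ 2 / Hk a k)).
  by field; rewrite gt_eqF // Hk_gt0.
apply: ler_wpM2l; first by rewrite mulr_ge0 ?sqr_ge0.
by apply: ler_wpM2l => //; rewrite lerDr.
Qed.

Lemma block_gform_le x : E = expR a^-1 -> towx a k <= x ->
  gform R (block a T k x) <=
  224 * c ^+ 4 * (E - 1) * (gk a k * (1 + hx a k x ^+ 2 / Hk a k)) ^+ 2.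
Proof.
move=> EE kx; have mh := large_primes_upper Mc (good_towx good) kx.
rewrite -/(hx a k x) -/(ep x) in mh *.
have h1 := hx_ge1 kx; have [c1 _] := Mc.
have z0 : 0 <= a^-1 by rewrite invr_ge0 ltW.
have ov := good_ovl good; rewrite EE in ov.
apply: le_trans (gform_blk_le _ _ _ z0 _ ov) _.
- exact: prange_prime.
- exact: large_filter_prime.
- exact: small_large_disjoint.
- by rewrite filter_uniq // prange_uniq.
have e2 : esym R (ep x) 2 <= mass R (ep x) ^+ 2 / 2.
  by have := esym_le R (ep x) 2; rewrite (_ : 2`! = 2)%N.
rewrite -EE -/(ep x).
exact: (gform_bound_num (esym_ge0 _ _ _) esym_le_H (mass_ge0 _ _) mh (esym_ge0 _ _ _)
  e2 c1 h1 Hk_gt0 E1 (good_E good h1)).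
Qed.

(** The threshold on [h] gives the large primes up to [x^(1/4)] a mass [m >= h / 2 + 1], so the
    lower bound [m (m - 1) / 2] for their second symmetric sum has order [h^2]. The cutoff [x^(1/4)]
    is the one needed in [block_le]. *)
Lemma block_mass_ge x : towx a k <= x -> x <= towx a k.+1 ->
  2 * (ln 4 + 2 * c) + 4 <= hx a k x ->
  gk a k * (hx a k x ^+ 2 / Hk a k) <= 16 * mass R (block a T k (quarter x)).
Proof.
move=> kx xk hK; rewrite mass_blk.
have := large_primes_lower Mc (good_towx good) kx xk.
rewrite -/(ep (quarter x)); set s := ep _; set m := mass R s => mh.
set h := hx a k x in hK *.
have hE : ln (ln x) - a * k%:R ^+ 2 = h - 1 by rewrite /h /hx addrK.
rewrite hE in mh.
have l4 := ln_nat_ge0 R 4; have [c1 _] := Mc.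
have m1 : h / 2 <= m by lra.
have m2 : h / 4 <= m - 1 by lra.
have e2 : h ^+ 2 / 16 <= esym R s 2.
  have := @esym_succ_ge R 1 s 1 ler01; rewrite esym1 mul1r -/m => /(_ _)/le_trans H.
  have : h / 4 * (h / 2) <= (m - 1) * m by apply: ler_pM => //; lra.
  have : (m - 1) * m <= 2 * esym R s 2.
    apply: H => // p; rewrite mem_filter => /andP[_ /(allP (prange_prime _ _)) pp].
    by rewrite invf_le1 ?ltr0n ?ler1n prime_gt0.
  lra.
have k0 := good_k_gt0.
have ak0 : 0 < 2 * a * k%:R by rewrite !mulr_gt0.
have g0 := gk_ge0 k (ltW a0).
have e1 : gk a k / Hk a k <= esym R (small_primes a T k) k.-1.
  apply: le_trans (good_esym_ge good); apply: ler_wpM2l => //.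
  have HE : 2 * a * k%:R <= Hk a k by have := a0; rewrite /Hk; lra.
  by rewrite lef_pV2 ?posrE ?Hk_gt0.
have h0 : 0 <= h ^+ 2 / 16 by rewrite divr_ge0 ?sqr_ge0.
have gH0 : 0 <= gk a k / Hk a k by rewrite divr_ge0 // ltW // Hk_gt0.
have := ler_pM gH0 h0 e1 e2; lra.
Qed.

(** The [k - 1] primes up to [x_k^(1/(2k))] multiply to at most [x^(1/2)], and so do two primes up
    to [x^(1/4)]. *)
Lemma block_le x n : towx a k <= x -> n \in block a T k (quarter x) -> n%:R <= x.
Proof.
move=> kx /allpairsP[[i j] /= [ns ms ->]]; rewrite natrM.
have x1 : 1 < x by apply: lt_le_trans (towx_gt1 a k) kx.
have x0 : 0 < x by lra.
have i_le : i%:R <= expR (ln x / 2).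
  apply: le_trans (@sqf_le _ _ _ _ (towy a k) _ _ ns) _; first exact: expR_ge0.
    by move=> p; rewrite mem_prange ?expR_ge0 // => /and3P[].
  rewrite /towy -expRM_natl ler_expR.
  have lx : expR (a * k%:R ^+ 2) <= ln x.
    by rewrite -[leLHS]expRK ler_ln ?posrE ?expR_gt0.
  apply: (@le_trans _ _ (expR (a * k%:R ^+ 2) / 2)); last by rewrite ler_pM2r.
  have k0 := good_k_gt0.
  have k1 : k.-1%:R <= k%:R :> R by rewrite ler_nat leq_pred.
  rewrite mulrA ler_pdivrMr ?mulr_gt0 //.
  have := ler_wpM2r (expR_ge0 (a * k%:R ^+ 2)) k1; lra.
have j_le : j%:R <= expR (ln x / 2).
  apply: le_trans (@sqf_le _ _ _ _ (quarter x) _ _ ms) _; first exact: expR_ge0.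
    by move=> p; rewrite mem_filter => /andP[].
  by rewrite /quarter -expRM_natl ler_expR; lra.
apply: (le_trans (ler_pM _ _ i_le j_le)) => //.
rewrite -expRD (_ : ln x / 2 + ln x / 2 = ln x); last by field.
by rewrite lnK.
Qed.

End GoodBlock.

End Construction.

(** * Part (i): the union of the blocks and its comparison with [F] *)

Section Assembly.
Variable R : realType.
Implicit Types (a c x T : R) (k : nat).

Lemma block_mono a T k x y : x <= y -> {subset block a T k x <= block a T k y}.
Proof.
move=> xy n /allpairsP[[i j] /= [ns ms ->]].
apply/allpairsP; exists (i, j); split => //=; apply: sqf_subset ms.
have -> : [seq p <- large_primes a k | p%:R <= x] =
   [seq p <- [seq p <- large_primes a k | p%:R <= y] | p%:R <= x].
  rewrite -filter_predI; apply: eq_filter => p /=.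
  by have [px|//] := leP p%:R x; rewrite (le_trans px xy).
exact: filter_subseq.
Qed.

(** The large primes of an element up to [x] are themselves at most [x]; so the witness up to [x] is
    covered by blocks cut at [x]. *)
Lemma mem_block_le a T k x y n : n \in block a T k y -> n%:R <= x ->
  n \in block a T k x.
Proof.
move=> /allpairsP[[i j] /= [ns ms ->]] nx.
apply/allpairsP; exists (i, j); split => //=.
have i0 : (0 < i)%N := sqf_gt0 (prange_prime _ _) ns.
have jx : j%:R <= x by apply: le_trans nx; rewrite ler_nat leq_pmull.
apply: sqf_subset (sqf_ge_entry (large_filter_prime _ _ _) ms jx).
have -> : [seq p <- [seq p <- large_primes a k | p%:R <= y] | p%:R <= x] =
   [seq p <- [seq p <- large_primes a k | p%:R <= x] | p%:R <= y].
  rewrite -filter_predI -[RHS]filter_predI; apply: eq_filter => p; exact: andbC.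
exact: filter_subseq.
Qed.

Lemma block_nil a T k x : x <= towx a k -> block a T k x = [::].
Proof.
move=> xk; rewrite /block (_ : [seq p <- _ | _] = [::]).
  by apply/eqP; rewrite -size_eq0 size_allpairs muln0.
rewrite -(filter_pred0 (large_primes a k)).
apply: eq_in_filter => p; rewrite mem_prange ?expR_ge0 // => /and3P[_ kp _] /=.
by apply/negbTE; rewrite -ltNge; exact: le_lt_trans kp.
Qed.

Lemma gform_nil : gform R [::] = 0.
Proof. by rewrite /gform big_nil. Qed.

Lemma gform_ge0 s : 0 <= gform R s.
Proof. by rewrite -gform_nil; apply: gform_subset. Qed.

Lemma mass_cat s t : mass R (s ++ t) = mass R s + mass R t.
Proof. by rewrite /mass big_cat. Qed.

Lemma quarter_le x : 1 <= x -> quarter x <= x.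
Proof.
move=> x1; have l0 := ln_ge0 x1.
have x0 : 0 < x by lra.
by rewrite /quarter -[leRHS](lnK x0) ler_expR; lra.
Qed.

Section Blocks.
Variables (a c T K : R) (J : nat).
Hypotheses (a0 : 0 < a) (Mc : mertens_const c).
Hypothesis KE : K = 2 * (ln 4 + 2 * c) + 4.
Hypothesis good : forall k, (J <= k)%N -> good_index a T (expR a^-1) K k.

Local Notation E := (expR a^-1).
Local Notation D := (224 * c ^+ 4 * (E - 1)).
Local Notation lam k x := (gk a k * (1 + hx a k x ^+ 2 / Hk a k)).

Definition blocks_below k : seq nat :=
  flatten [seq block a T j (towx a j.+1) | j <- index_iota J k].

Lemma E_gt1 : 1 < E.
Proof. by rewrite expR_gt1 invr_gt0. Qed.

Lemma D_ge0 : 0 <= D.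
Proof.
have [c1 _] := Mc; have E1 := E_gt1.
by apply: mulr_ge0; [apply: mulr_ge0 => //; apply: exprn_ge0; lra | lra].
Qed.

Lemma blocks_belowS k : (J <= k)%N ->
  blocks_below k.+1 = blocks_below k ++ block a T k (towx a k.+1).
Proof.
move=> Jk; rewrite /blocks_below /index_iota subSn // -addn1 iotaD map_cat flatten_cat.
by rewrite subnKC //= cats0.
Qed.

Lemma blocks_below_gt0 k : all (ltn 0) (blocks_below k).
Proof.
apply/allP => n /flatten_mapP[j _]; exact: (allP (block_gt0 _ _ _ _)).
Qed.

(** At [x_(k+1)] the value of [h] is [Hk], so the weight is [gk (1 + Hk)], of the order of the next
    [gk]. *)
Lemma block_full_weight k : (J <= k)%N -> lam k (towx a k.+1) <= 4 * gk a k.+1.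
Proof.
move=> Jk; have gd := good Jk; rewrite hx_towx.
have H0 := Hk_gt0 k a0.
rewrite expr2 mulfK ?gt_eqF //.
have k0 : (0 < k)%N by rewrite (ltn_trans _ (good_pos gd)).
have g1 := gkS_ge a0 k0.
have g0 := gk_ge0 k (ltW a0).
have : 1 + Hk a k <= 4 * (a * k.+1%:R).
  have := good_ratio gd; have := a0; rewrite /Hk -natr1.
  have : 0 <= a * k%:R by rewrite mulr_ge0 // ltW.
  lra.
move=> /(ler_wpM2l g0); lra.
Qed.

Lemma gk_double k : (J <= k)%N -> 2 * gk a k <= gk a k.+1.
Proof.
move=> Jk; have gd := good Jk.
have k0 : (0 < k)%N by rewrite (ltn_trans _ (good_pos gd)).
apply: le_trans (gkS_ge a0 k0); rewrite mulrC.
by apply: ler_wpM2l; [exact: gk_ge0 (ltW a0) | exact: good_ratio gd].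
Qed.

Lemma good_gk_gt0 k : (J <= k)%N -> 0 < gk a k.
Proof. by move=> Jk; rewrite gk_gt0 // (ltn_trans _ (good_pos (good Jk))). Qed.

(** Geometric growth: up to the factor [c^2], the induction reads
    [64 g_k + 32 g_(k+1) <= 64 g_(k+1)], by [gk_double]. *)
Lemma blocks_below_mass k : (J <= k)%N ->
  mass R (blocks_below k) <= 64 * c ^+ 2 * gk a k.
Proof.
elim: k => [|k IH].
  rewrite leqn0 => /eqP J0; rewrite /blocks_below J0 /mass big_nil.
  by rewrite mulr_ge0 ?gk_ge0 ?(ltW a0) // mulr_ge0 // sqr_ge0.
rewrite leq_eqVlt => /predU1P[Jk|].
  rewrite /blocks_below Jk /index_iota subnn /mass big_nil.
  by rewrite mulr_ge0 ?gk_ge0 ?(ltW a0) // mulr_ge0 // sqr_ge0.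
rewrite ltnS => Jk; rewrite blocks_belowS // mass_cat.
have h1 := IH Jk.
have kk : towx a k <= towx a k.+1 by apply: towx_mono => //; exact: ltW.
have h2 := block_mass_le a0 Mc (good Jk) kk.
have h3 := block_full_weight Jk; have h4 := gk_double Jk.
have c0 : 0 <= c ^+ 2 by exact: sqr_ge0.
have := ler_wpM2l c0 h3; have := ler_wpM2l c0 h4.
lra.
Qed.

(** The same induction for square roots, through [gform_cat]: [8 g_k + 4 g_(k+1) <= 8 g_(k+1)]. *)
Lemma blocks_below_gform k : (J <= k)%N ->
  gform R (blocks_below k) <= D * (8 * gk a k) ^+ 2.
Proof.
elim: k => [|k IH].
  rewrite leqn0 => /eqP J0; rewrite /blocks_below J0 gform_nil.
  by rewrite mulr_ge0 ?D_ge0 // sqr_ge0.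
rewrite leq_eqVlt => /predU1P[Jk|].
  rewrite /blocks_below Jk /index_iota subnn gform_nil.
  by rewrite mulr_ge0 ?D_ge0 // sqr_ge0.
rewrite ltnS => Jk; rewrite blocks_belowS //.
have kk : towx a k <= towx a k.+1 by apply: towx_mono => //; exact: ltW.
have h2 := block_gform_le a0 Mc E_gt1 (good Jk) erefl kk.
have h3 := block_full_weight Jk; have h4 := gk_double Jk.
have g0 := good_gk_gt0 Jk.
have lam0 : 0 <= lam k (towx a k.+1).
  by rewrite mulr_ge0 ?(ltW g0) // addr_ge0 // divr_ge0 ?sqr_ge0 // ltW // Hk_gt0.
have {}h2 : gform R (block a T k (towx a k.+1)) <= D * (4 * gk a k.+1) ^+ 2.
  apply: (le_trans h2); apply: ler_wpM2l; first exact: D_ge0.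
  by rewrite ler_sqr ?nnegrE //; apply: le_trans h3.
apply: le_trans (gform_cat (blocks_below_gt0 k) (block_gt0 _ _ _ _) _ _ (IH Jk) h2) _.
- by lra.
- by lra.
apply: ler_wpM2l; first exact: D_ge0.
by rewrite ler_sqr ?nnegrE; lra.
Qed.

Definition witness : set nat :=
  [set n | exists2 k, (J <= k)%N & n \in block a T k (towx a k.+1)].

Lemma witness_gt0 n : witness n -> (0 < n)%N.
Proof. by move=> [k _]; exact: (allP (block_gt0 _ _ _ _)). Qed.

Section AtX.
Variables (k : nat) (x : R).
Hypotheses (Jk : (J < k)%N) (kx : towx a k < x) (xk : x <= towx a k.+1).

Lemma lam_ge : gk a k <= lam k x.
Proof.
have g0 := good_gk_gt0 (ltnW Jk).
rewrite ler_peMr ?(ltW g0) // lerDl divr_ge0 ?sqr_ge0 // ltW //.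
exact: Hk_gt0.
Qed.

Lemma witness_subset (s : seq nat) : (forall n, n \in s -> witness n /\ n%:R <= x) ->
  {subset s <= blocks_below k ++ block a T k x}.
Proof.
move=> sA n /sA[[j Jj nj] nx]; have njx := mem_block_le nj nx.
rewrite mem_cat; have [jk|kj|jk] := ltngtP j k.
- apply/orP; left; apply/flatten_mapP; exists j => //.
  by rewrite mem_index_iota Jj.
- have xj : x <= towx a j by apply: le_trans xk _; apply: towx_mono => //; exact: ltW.
  by move: njx; rewrite block_nil.
by rewrite -jk njx orbT.
Qed.

Lemma witness_mass_le (s : seq nat) : uniq s ->
  (forall n, n \in s -> witness n /\ n%:R <= x) ->
  mass R s <= 72 * c ^+ 2 * lam k x.
Proof.
move=> us sA.
apply: (@le_trans _ _ (mass R (blocks_below k ++ block a T k x))).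
  by apply: sum_seq_subset => //; exact: witness_subset.
rewrite mass_cat.
have h1 := blocks_below_mass (ltnW Jk).
have h2 := block_mass_le a0 Mc (good (ltnW Jk)) (ltW kx).
have c0 : 0 <= c ^+ 2 by exact: sqr_ge0.
have := ler_wpM2l c0 lam_ge; lra.
Qed.

(** In square roots, the earlier blocks count for [8 gk], at most 8 times the weight of block [k];
    hence [81 = (8 + 1)^2]. *)
Lemma witness_gform_le (s : seq nat) : uniq s ->
  (forall n, n \in s -> witness n /\ n%:R <= x) ->
  gform R s <= 81 * D * lam k x ^+ 2.
Proof.
move=> us sA.
apply: (le_trans (gform_subset R us (witness_subset sA))).
have g0 := good_gk_gt0 (ltnW Jk); have l0 := lam_ge.
have h2 := block_gform_le a0 Mc E_gt1 (good (ltnW Jk)) erefl (ltW kx).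
have u0 : 0 < 8 * gk a k by lra.
have v0 : 0 < lam k x by apply: lt_le_trans l0.
apply: (le_trans (gform_cat (blocks_below_gt0 k) (block_gt0 _ _ _ _) u0 v0
   (blocks_below_gform (ltnW Jk)) h2)).
have -> : 81 * D * lam k x ^+ 2 = D * (9 * lam k x) ^+ 2 by ring.
apply: ler_wpM2l; first exact: D_ge0.
by rewrite ler_sqr ?nnegrE; lra.
Qed.

Lemma block_sub_upto (s : seq nat) j y : (forall n, witness n /\ n%:R <= x -> n \in s) ->
  (J <= j)%N -> towx a j <= y -> y <= x -> y <= towx a j.+1 ->
  mass R (block a T j (quarter y)) <= mass R s.
Proof.
move=> sA Jj jy yx yj; apply: sum_seq_subset => //.
  apply: blk_uniq; [exact: prange_prime | exact: large_filter_prime | | exact: prange_uniq |].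
    exact: (small_large_disjoint (good Jj)).
  by rewrite filter_uniq // prange_uniq.
move=> n nb; apply: sA; split; last by apply: le_trans yx; move: nb; apply: block_le => //; exact: good.
exists j => //; apply: block_mono nb; apply: le_trans yj; apply: quarter_le.
by apply: le_trans jy; rewrite ltW // towx_gt1.
Qed.

(** The two terms of [psi] come from different blocks: the full block [k - 1], available because
    [J < k], has mass at least of order [gk], and block [k] supplies [gk h^2 / Hk] once [h >= K].
    For [h < K] that term is at most [gk]. *)
Lemma witness_mass_ge (s : seq nat) : (forall n, witness n /\ n%:R <= x -> n \in s) ->
  lam k x <= 32 * expR 2 * mass R s.
Proof.
move=> sA; set L := mass R s.
have e2 : 1 <= expR 2 :> R by rewrite -[leLHS]expR0 ler_expR.
have L0 : 0 <= L by exact: mass_ge0.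
have eL : L <= expR 2 * L by rewrite ler_peMl.
have K4 : 4 <= K by have := ln_nat_ge0 R 4; have [c1 _] := Mc; rewrite KE; lra.
have h1 : gk a k <= 16 * expR 2 * L.
  have kE : k = k.-1.+1 by rewrite (ltn_predK Jk).
  set j := k.-1 in kE; have Jj : (J <= j)%N by rewrite -ltnS -kE.
  have gd := good Jj; have j0 : (0 < j)%N by rewrite (ltn_trans _ (good_pos gd)).
  have jk : towx a j <= towx a k by apply: towx_mono; [exact: ltW | rewrite kE].
  have H0 := Hk_gt0 j a0.
  have H1 : 1 <= Hk a j.
    by rewrite /Hk lerDr mulr_ge0 ?(ltW a0) // addr_ge0 // mulr_ge0.
  have HK : K <= Hk a j.
    apply: le_trans (good_K gd); rewrite expr2 ler_peMr; lra.
  have hj : hx a j (towx a k) = Hk a j by rewrite kE hx_towx.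
  have kk : towx a k <= towx a j.+1 by rewrite -kE.
  have hKj : 2 * (ln 4 + 2 * c) + 4 <= hx a j (towx a k) by rewrite hj -KE.
  (* At [x_k] the block [j = k - 1] has [h^2 / Hk = Hk], which is at least [a k]; by [gkS_le] this
     factor lifts [gk a j] to [gk a k] up to [exp 2]. *)
  have := block_mass_ge a0 Mc gd jk kk hKj.
  rewrite hj expr2 mulfK ?gt_eqF // => m1.
  have m2 := block_sub_upto sA Jj jk (ltW kx) kk.
  rewrite -/L in m2.
  have g1 := gkS_le a0 j0; rewrite -kE in g1.
  have g0 := gk_ge0 j (ltW a0).
  have Ha : a * k%:R <= Hk a j.
    have : 0 <= a * j%:R by rewrite mulr_ge0 // ltW.
    have := a0; rewrite kE /Hk -natr1; lra.
  have m3 : gk a j * (a * k%:R) <= 16 * L.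
    by apply: le_trans (ler_wpM2l g0 Ha) _; lra.
  have := ler_wpM2r (expR_ge0 2) m3; lra.
have [hK|hK] := leP K (hx a k x).
  rewrite KE in hK.
  have m1 := block_mass_ge a0 Mc (good (ltnW Jk)) (ltW kx) xk hK.
  have m2 := block_sub_upto sA (ltnW Jk) (ltW kx) (lexx x) xk.
  rewrite -/L in m2.
  rewrite mulrDr mulr1; lra.
have hx1 := hx_ge1 (ltW kx).
have H0 := Hk_gt0 k a0.
have : hx a k x ^+ 2 / Hk a k <= 1.
  rewrite ler_pdivrMr // mul1r; apply: le_trans (good_K (good (ltnW Jk))).
  by rewrite ler_sqr ?nnegrE; lra.
have g0 := gk_ge0 k (ltW a0).
move=> /(ler_wpM2l g0); rewrite mulr1 mulrDr mulr1; lra.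
Qed.

End AtX.
End Blocks.

Lemma xk_towx (C0 : R) k : xk C0 k = towx (C0 ^+ 2)^-1 k.
Proof. by rewrite /xk /towx mulrC. Qed.

Lemma kof_eq (C0 : R) x k : 0 < C0 -> kblock C0 x k -> kof C0 x = k.
Proof.
by move=> C00 kb; apply: xget_unique => // l; exact: (fun hl => kblock_uniq C00 hl kb).
Qed.

Lemma F_lam (C0 : R) x k : 0 < C0 -> kblock C0 x k ->
  let a := (C0 ^+ 2)^-1 in
  F C0 x = gk a k * (1 + hx a k x ^+ 2 / Hk a k).
Proof.
move=> C00 kb a; have [C0k /andP[kx xk1]] := kb.
(* The intervals are closed on the right, so [x_(k+1)] has the same index [k] and the denominator in
   [psi] is [Hk]. *)
have kb' : kblock C0 (xk C0 k.+1) k.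
  by split=> //; rewrite lexx andbT; exact: lt_le_trans kx xk1.
have C2 : 0 < C0 ^+ 2 by rewrite exprn_gt0.
(* From [k >= C0]; hence the truncations in [Log] are inactive from [x_k] on. *)
have ak1 : 1 <= a * k%:R ^+ 2.
  rewrite /a mulrC ler_pdivlMr // mul1r ler_sqr ?nnegrE ?(ltW C00) //.
have Log2E y : towx a k <= y -> Log2 y = ln (ln y).
  move=> ky; have y1 : 1 < y by apply: lt_le_trans (towx_gt1 a k) ky.
  have lly : 1 <= ln (ln y) by apply: le_trans ak1 _; rewrite -towx_le.
  have ly : 1 <= ln y.
    have l0 : 0 < ln y by rewrite ln_gt0.
    by have := @ln_le_subr1 R _ l0; lra.
  by rewrite /Log2 /Log (max_l ly) max_l.
rewrite xk_towx -/a in kx; rewrite xk_towx -/a in xk1.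
have hE y : kblock C0 y k -> h C0 y = hx a k y.
  move=> ky; rewrite /h (kof_eq C00 ky) Log2E; last first.
    by case: ky => _ /andP[/ltW + _]; rewrite xk_towx.
  by rewrite /hx /a [_ / C0 ^+ 2]mulrC.
rewrite /F /psi (kof_eq C00 kb) (hE x kb) (hE _ kb') xk_towx -/a hx_towx mulrC.
congr (_ * _); rewrite /gk; congr (_ / _).
by rewrite exprMn -exprM mulrC /a exprVn -exprM.
Qed.

Lemma kblock_near (C0 : R) (N : nat) : 0 < C0 ->
  \forall x \near +oo, exists2 k, (N <= k)%N & kblock C0 x k.
Proof.
move=> C00; pose M := (N + Num.truncn C0)%N.+1.
have C2 : 0 < C0 ^+ 2 by rewrite exprn_gt0.
near=> x.
have Mx : xk C0 M < x by near: x; apply: nbhs_pinfty_gt; rewrite num_real.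
have ex : exists k, x <= xk C0 k.
  pose k := (Num.truncn (C0 ^+ 2 * `|x|)).+1; exists k.
  have kb : C0 ^+ 2 * `|x| <= k%:R by rewrite ltW // truncnS_gt.
  have k1 : 1 <= k%:R :> R by rewrite ler1n.
  have kk : k%:R <= k%:R ^+ 2 :> R by rewrite expr2 ler_peMr.
  have xu : x <= k%:R ^+ 2 / C0 ^+ 2.
    rewrite ler_pdivlMr // mulrC; apply: le_trans kk; apply: le_trans kb.
    by rewrite ler_pM2l // ler_norm.
  rewrite /xk; set u := _ / _ in xu *.
  have := @expR_ge1Dx R u; have := @expR_ge1Dx R (expR u); lra.
(* The least [k] with [x <= x_k] is one more than the index sought. *)
have [k xk_k kmin] := ex_minnP ex.
have Mk : (M < k)%N.
  rewrite ltnNge; apply/negP => kM.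
  have := lt_le_trans Mx xk_k; rewrite !xk_towx ltNge towx_mono // invr_ge0 ltW //.
have kE : k = k.-1.+1 by rewrite (ltn_predK Mk).
have Mk1 : (M <= k.-1)%N by rewrite -ltnS -kE.
exists k.-1; first by apply: leq_trans Mk1; rewrite /M; lia.
split.
  apply: (@le_trans _ _ M%:R); last by rewrite ler_nat.
  apply: ltW; apply: lt_le_trans (truncnS_gt C0) _.
  by rewrite ler_nat /M ltnS leq_addl.
rewrite -kE xk_k andbT ltNge; apply/negP => /kmin; rewrite {1}kE ltnn //.
Unshelve. all: by end_near. Qed.

Lemma gcd_construction :
  exists2 C : R, 0 < C &
     forall C0 : R, 0 < C0 ->
     exists A : set nat,
       [/\ forall n, A n -> (0 < n)%N,
           \forall x \near +oo, asymp C (logsum A x) (F C0 x) &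
           exists2 o : R -> R, o x @[x --> +oo] --> (0 : R) &
             \forall x \near +oo,
               ll C (Egcd A x - 1) (expR (expR 1 ^+ 2 * C0 ^+ 2) - 1 + o x)].
Proof.
have [c c1 Hc] := recp_bound_real R.
have Mc : mertens_const c by split.
pose K := 2 * (ln 4 + 2 * c) + 4 : R.
pose B := 32 * expR 2 : R; have B0 : 0 < B by rewrite mulr_gt0 ?expR_gt0.
(* The summands serve, in order, the upper bound for the mass, the lower bound, and the gcd
   bound. *)
pose C := 72 * c ^+ 2 + B + 81 * (224 * c ^+ 4) * B ^+ 2.
have t1 : 0 <= 72 * c ^+ 2 by rewrite mulr_ge0 // sqr_ge0.
have t2 : 0 <= 81 * (224 * c ^+ 4) * B ^+ 2.
  apply: mulr_ge0; last exact: sqr_ge0.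
  by apply: mulr_ge0 => //; apply: mulr_ge0 => //; apply: exprn_ge0; lra.
exists C; first by rewrite /C; lra.
move=> C0 C00; pose a := (C0 ^+ 2)^-1.
have C2 : 0 < C0 ^+ 2 by rewrite exprn_gt0.
have a0 : 0 < a by rewrite invr_gt0.
have [T T2 [J _ good]] := good_index_near K a0 Mc.
have {}good k : (J <= k)%N -> good_index a T (expR a^-1) K k by exact: good.
exists (witness a T J).
have facts x k : (J < k)%N -> kblock C0 x k ->
  [/\ 0 < F C0 x, logsum (witness a T J) x <= 72 * c ^+ 2 * F C0 x,
      F C0 x <= B * logsum (witness a T J) x &
      0 <= Egcd (witness a T J) x - 1 <=
        81 * (224 * c ^+ 4 * (expR a^-1 - 1)) * B ^+ 2].
  move=> Jk kb; have [_ /andP[]] := kb; rewrite !xk_towx -/a => kx xk1.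
  rewrite (F_lam C00 kb) -/a.
  have [s [us sA LE EE]] := upto_seq (witness a T J) x.
  have sA1 n : n \in s -> witness a T J n /\ n%:R <= x by move/sA.
  have sA2 n : witness a T J n /\ n%:R <= x -> n \in s by move/sA.
  have lo := witness_mass_ge a0 Mc (erefl K) good Jk kx xk1 sA2.
  have up := witness_mass_le a0 Mc good Jk kx xk1 us sA1.
  have gu := witness_gform_le a0 Mc good Jk kx xk1 us sA1.
  have lg := lam_ge a0 good x Jk.
  set l := gk a k * _ in lo up gu lg *.
  have l0 : 0 < l by apply: lt_le_trans lg; exact: (gk_gt0 a0 (leq_ltn_trans (leq0n J) Jk)).
  have m0 : 0 < mass R s by rewrite -(pmulr_rgt0 _ B0); apply: lt_le_trans lo.
  split; rewrite ?LE //.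
  rewrite (EE (@witness_gt0 a T J) m0) divr_ge0 ?gform_ge0 ?sqr_ge0 //=.
  rewrite ler_pdivrMr ?exprn_gt0 //; apply: le_trans gu _.
  rewrite -[leRHS]mulrA -exprMn; apply: ler_wpM2l.
    by rewrite mulr_ge0 // D_ge0.
  by rewrite ler_sqr ?nnegrE ?(ltW l0) // mulr_ge0 ?ltW.
split.
- exact: witness_gt0.
- near=> x.
  have [k Jk kb] : exists2 k, (J.+1 <= k)%N & kblock C0 x k.
    by near: x; exact: kblock_near.
  have [F0 up lo _] := facts x k Jk kb.
  set L := logsum _ _ in up lo *.
  have L0 : 0 < L by rewrite -(pmulr_rgt0 _ B0); apply: lt_le_trans lo.
  have CF D' y : 0 <= D' -> D' <= C -> 0 <= y -> D' * y <= C * y.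
    by move=> _ DC y0; exact: ler_wpM2r.
  split; rewrite /ll gtr0_norm //.
    by apply: le_trans up _; apply: CF; rewrite ?(ltW F0) // /C; lra.
  by apply: le_trans lo _; apply: CF; rewrite ?(ltW L0) // /C; lra.
(* For all large [x] the blocks give a constant multiple of [exp (C0^2) - 1], which is at most
   [exp (e^2 C0^2) - 1]; so the zero function serves as the error. *)
exists (fun=> 0); first exact: cvg_cst.
near=> x.
have [k Jk kb] : exists2 k, (J.+1 <= k)%N & kblock C0 x k.
  by near: x; exact: kblock_near.
have [_ _ _ /andP[e0 e1]] := facts x k Jk kb.
rewrite /ll ger0_norm // addr0; apply: le_trans e1 _.
rewrite /a invrK.
have e1 : 1 <= expR 1 ^+ 2 :> R.
  by rewrite exprn_ege1 // -[leLHS]expR0 ler_expR.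
have E0 : 0 <= expR (C0 ^+ 2) - 1 by rewrite subr_ge0 -[leLHS]expR0 ler_expR ltW.
have EE : expR (C0 ^+ 2) - 1 <= expR (expR 1 ^+ 2 * C0 ^+ 2) - 1.
  by rewrite lerD2r ler_expR ler_peMl // ltW.
have -> : 81 * (224 * c ^+ 4 * (expR (C0 ^+ 2) - 1)) * B ^+ 2 =
  81 * (224 * c ^+ 4) * B ^+ 2 * (expR (C0 ^+ 2) - 1) by ring.
by apply: ler_pM => //; rewrite /C; lra.
Unshelve. all: by end_near. Qed.

End Assembly.

Theorem theorem1p2 (R : realType) :
  (exists2 C : R, 0 < C &
     forall C0 : R, 0 < C0 ->
     exists A : set nat,
       [/\ forall n, A n -> (0 < n)%N,
           \forall x \near +oo, asymp C (logsum A x) (F C0 x) &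
           exists2 o : R -> R, o x @[x --> +oo] --> (0 : R) &
             \forall x \near +oo,
               ll C (Egcd A x - 1) (expR (expR 1 ^+ 2 * C0 ^+ 2) - 1 + o x)])
  /\
  (forall C0 : R, 0 < C0 ->
     exists2 o : R -> R, o x @[x --> +oo] --> (0 : R) &
       \forall x \near +oo,
         forall A : set nat,
           (forall n, A n -> (0 < n)%N) ->
           upto A x !=set0 ->
           Egcd A x - 1 <= C0 ^+ 2 ->
           logsum A x
             <= expR ((C0 + o x) * Num.sqrt (Log2 x) * Log3 x)).
Proof. by split; [exact: gcd_construction | exact: logsum_upper_bound]. Qed.
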